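(* Let $n\ge 1$ and let $F$ satisfy the standing assumptions below together with the smallness-of-third-derivatives condition (SC) with a constant $C_1$ satisfying $C_1^2<4n^{-1/2}$. Let $T>0$, $M>0$, and let $u:\mathbb{R}^n\times[0,T]\to\mathbb{R}$ be a $C^3$ solution of the anisotropic mean curvature flow equation (AMCF) with $|u(x,t)|\le M$ for all $(x,t)$, which is periodic with respect to a lattice $L\subset\mathbb{R}^n$, i.e. $u(x+\ell,t)=u(x,t)$ for all $\ell\in L$. Then there are constants $A>0$, $P>F(-\phi^0)$ and $q>1$ depending only on $F$ (and $n$, $C_1$), and a time $T'\in(0,T]$ depending on $M$ (and $A$), such that $$F(Du-\phi^0)(x,t)\le \max\left\{ t^{q/2}\exp\!\left(\frac{Aq\,(|u(x,t)|-2M)^2}{4t}\right),\ P\right\}$$ for all $x\in\mathbb{R}^n$ and all $0<t\le T'$.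
   Context: Let $V\cong\mathbb{R}^{n+1}$ with basis $e_0,e_1,\dots,e_n$ and let $V^*$ have the dual basis $\phi^0,\phi^1,\dots,\phi^n$. Standing assumptions on $F$: $F:V^*\to\mathbb{R}$ is positive (on $V^*\setminus\{0\}$), convex, $C^3$ on $V^*\setminus\{0\}$, homogeneous of degree one ($F(\lambda v)=\lambda F(v)$ for $\lambda>0$), and each sublevel set $\{v\in V^*: F(v)\le\lambda\}$ is uniformly convex. Write $\Sigma_\lambda=\{v: F(v)=\lambda\}$; a vector $p\in V^*$ is tangent to $\Sigma_{F(\nu)}$ at $\nu$ iff $DF|_\nu(p)=0$. $D^kF|_\nu$ denotes the $k$-th derivative of $F$ at $\nu$ as a symmetric $k$-linear form on $V^*$. For a function $u(y,t)$, $y=(y^1,\dots,y^n)\in\mathbb{R}^n$, write $u_i=\partial u/\partial y^i$, $u_{ij}=\partial^2u/\partial y^i\partial y^j$, $Du=\sum_{i=1}^n u_i\phi^i\in V^*$. The anisotropic mean curvature flow equation (AMCF) is $$u_t=\sum_{i,j=1}^n F(\nu)\,D^2F|_{\nu}(\phi^i,\phi^j)\,u_{ij},\qquad \nu=Du-\phi^0 .$$ Smallness-of-third-derivatives condition (SC) with constant $C_1>0$: for every $\nu\in V^*\setminus\{0\}$ and all $p,q,r\in V^*$ tangent to $\Sigma_{F(\nu)}$ at $\nu$, $$F(\nu)^2D^3F|_\nu(p,q,r)\le C_1\Big[F(\nu)^3\,D^2F|_\nu(p,p)\,D^2F|_\nu(q,q)\,D^2F|_\nu(r,r)\Big]^{1/2}.$$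 *)

(* Defs.v *)
From HB Require Import structures.
From mathcomp Require Import all_boot all_order all_algebra.
From mathcomp Require Import all_classical all_reals all_analysis.
Set Implicit Arguments. Unset Strict Implicit. Unset Printing Implicit Defensive.
Import Order.TTheory GRing.Theory Num.Theory.
Import numFieldNormedType.Exports.
Local Open Scope classical_set_scope.
Local Open Scope ring_scope.

Section Defs.
Variable R : realType.

Fixpoint iterD (V : normedModType R) (f : V -> R) (vs : seq V) : V -> R :=
  match vs with
  | [::] => f
  | v :: vs' => fun x => derive (iterD f vs') x v
  end.

Definition Ck_on (V : normedModType R) (k : nat) (f : V -> R) (A : set V) : Prop :=
  open A /\
  forall vs : seq V, (size vs <= k)%N -> forall x, A x ->
    (match vs with
     | [::] => True
     | v :: vs' => derivable (iterD f vs') x v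
     end) /\ {for x, continuous (iterD f vs)}.

(* V* = R^{n+1} as row vectors, basis phi^0, ..., phi^n *)
Definition phi (n : nat) (j : 'I_n.+1) : 'rV[R]_n.+1 := delta_mx 0 j.
Definition phi0 (n : nat) : 'rV[R]_n.+1 := phi ord0.

Definition D1 n (F : 'rV[R]_n.+1 -> R) nu p := derive F nu p.
Definition D2 n (F : 'rV[R]_n.+1 -> R) nu p q := iterD F [:: p; q] nu.
Definition D3 n (F : 'rV[R]_n.+1 -> R) nu p q r := iterD F [:: p; q; r] nu.

Definition tangent n (F : 'rV[R]_n.+1 -> R) (nu p : 'rV[R]_n.+1) : Prop :=
  D1 F nu p = 0.

Definition standing_assumptions n (F : 'rV[R]_n.+1 -> R) : Prop :=
  [/\ (forall v, v != 0 -> 0 < F v),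
      (forall v w (a : R), 0 <= a <= 1 ->
          F (a *: v + (1 - a) *: w) <= a * F v + (1 - a) * F w),
      Ck_on 3 F (~` [set 0]),
      (forall (lam : R) v, 0 < lam -> F (lam *: v) = lam * F v) &
      (* uniform convexity of the sublevel sets {F <= F nu}: the second
         fundamental form of the level set Sigma_{F nu} at nu is positive
         definite, i.e. D^2F|_nu is positive definite on the tangent space *)
      (forall nu p, nu != 0 -> p != 0 -> tangent F nu p -> 0 < D2 F nu p p)].

Definition SC n (F : 'rV[R]_n.+1 -> R) (C1 : R) : Prop :=
  forall nu p q r, nu != 0 ->
    tangent F nu p -> tangent F nu q -> tangent F nu r ->
    F nu ^+ 2 * D3 F nu p q r <=
      C1 * Num.sqrt (F nu ^+ 3 * D2 F nu p p * D2 F nu q q * D2 F nu r r).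

Definition e n (i : 'I_n) : 'rV[R]_n := delta_mx 0 i.

Definition ust n (u : 'rV[R]_n -> R -> R) : 'rV[R]_n * R -> R :=
  fun z => u z.1 z.2.

Definition u_i n (u : 'rV[R]_n -> R -> R) (i : 'I_n) y t : R :=
  derive (fun y' => u y' t) y (e i).
Definition u_ij n (u : 'rV[R]_n -> R -> R) (i j : 'I_n) y t : R :=
  derive (fun y' => u_i u j y' t) y (e i).
Definition u_t n (u : 'rV[R]_n -> R -> R) y t : R :=
  derive (fun s : R => u y s) t 1.

Definition Du n (u : 'rV[R]_n -> R -> R) y t : 'rV[R]_n.+1 :=
  \sum_(i < n) u_i u i y t *: phi (lift ord0 i).

Definition nu_of n (u : 'rV[R]_n -> R -> R) y t : 'rV[R]_n.+1 :=
  Du u y t - phi0 n.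

Definition AMCF_at n (F : 'rV[R]_n.+1 -> R) (u : 'rV[R]_n -> R -> R) y t : Prop :=
  u_t u y t = \sum_(i < n) \sum_(j < n)
     F (nu_of u y t) * D2 F (nu_of u y t) (phi (lift ord0 i)) (phi (lift ord0 j))
       * u_ij u i j y t.

Definition lattice_periodic n (B : 'M[R]_n) (u : 'rV[R]_n -> R -> R) (T : R) : Prop :=
  B \in unitmx /\
  forall (k : 'I_n -> int) x t, 0 <= t <= T ->
    u (x + \sum_(i < n) (k i)%:~R *: row i B) t = u x t.

End Defs.

(* Main.v *)
Require Import Defs.
From HB Require Import structures.
From mathcomp Require Import all_boot all_order all_algebra.
From mathcomp Require Import all_classical all_reals all_analysis.
From mathcomp Require Import ring lra.
Import Order.TTheory GRing.Theory Num.Theory.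
Import numFieldNormedType.Exports.
Local Open Scope classical_set_scope.
Local Open Scope ring_scope.
Set Implicit Arguments. Unset Strict Implicit. Unset Printing Implicit Defensive.

(* A two-point maximum principle (Andrews-Clutterbuck).  Compare the oscillation
   of u with the explicit barrier
     rho(z,t) = e^(-B/t) (e^(kz/t) - 1),  k = 4M/c,  B = 2kM,
   by maximising rho((u(y,t) - u(x,t))/2, t) - |y - x|/2 over x, y and t.  At a
   positive maximum the gradients at x and y agree and are parallel to y - x, so
   both points see the same coefficients a(Du) = F D^2F.  Moving x and y in
   parallel shows that D^2u(y) - D^2u(x) is negative semidefinite, and moving
   them apart bounds it in the direction y - x in terms of rho''.  Homogeneity of
   F and compactness of the unit sphere give a(p) >= c/(1 + |p|^2), and rho is a
   strict subsolution of rho_t = c rho''/(1 + rho'^2), a contradiction.  Hence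
   |Du| <= 1/rho'(0,t) = (t/k) e^(B/t), which the right-hand side dominates for
   small t with q = 2. *)

(** Read [two_point x y t <= 0] as a modulus of continuity: with rho^(-1) the inverse of rho(., t),
    it says that u(y) - u(x) <= 2 rho^(-1)(|y - x|/2). Comparing through rho instead of its inverse
    keeps the barrier in closed form. The bound may depend on M only, so the initial gradient must
    not enter. Half the oscillation is at most M, hence rho < e^((kM - B)/t) = e^(-kM/t), which
    tends to 0 with t uniformly in x and y; this replaces an initial condition and explains the
    factor 2 in B = 2kM. The value k = 4M/c then turns the subsolution condition 2B <= c k^2 into an
    equality. The ellipticity degenerates like c/(1 + |p|^2) for steep graphs, but inversion
    compensates: at the maximum |p| = 1/rho', so the diffusion term is c/(1 + |p|^2) * rho''/rho'^2
    = c rho''/(1 + rho'^2), which is uniformly parabolic as long as rho' <= 1. For small t this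
    slope bound holds wherever half the oscillation is at most M. *)

(** * Differentiation along lines *)

Section OneVariable.
Context {R : realType}.
Implicit Types f g : R -> R.

(** If [g2] were positive, [g1] would be positive just to the right of its zero at 0, and the mean
    value theorem would make [g] exceed its maximum there. *)
Lemma MVT_le0_deriv2 g g1 (g2 : R) :
  (\forall s \near (0 : R), is_derive (s : R) (1 : R) g (g1 s)) -> is_derive (0 : R) 1 g1 g2 ->
  (\forall s \near (0 : R), g s <= g 0) -> g1 0 = 0 /\ g2 <= 0.
Proof.
move=> dg dg1 gmax.
have : \forall s \near (0 : R), is_derive (s : R) (1 : R) g (g1 s) /\ g s <= g 0.
  by near=> s; split; near: s.
move=> /nbhs_ballP[r /= r0 rP].
have Pr s : `|s| < r -> is_derive (s : R) (1 : R) g (g1 s) /\ g s <= g 0.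
  by move=> sr; apply: rP; rewrite /ball /= sub0r normrN.
have g10 : g1 0 = 0.
  have [d0 _] : is_derive (0 : R) (1 : R) g (g1 0) /\ g 0 <= g 0 by apply: Pr; rewrite normr0.
  rewrite -(@derive_val _ _ _ _ _ _ _ d0).
  apply: (@derive_val _ _ _ _ _ _ _ (@derive1_at_max _ g (- r) r _ _ _ _ _)).
  - by rewrite ge0_cp// ltW.
  - by move=> t; rewrite in_itv /= -ltr_norml => /Pr[[]].
  - by rewrite in_itv/= oppr_lt0 r0.
  - by move=> t; rewrite in_itv /= -ltr_norml => /Pr[].
split=> //; rewrite leNgt; apply/negP => g20.
have [dg1' g1E] := dg1.
have : (fun h => h^-1 *: (g1 (h *: 1 + 0) - g1 0)) @ 0^' --> g2.
  by rewrite -g1E; exact: dg1'.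
move=> /cvgr_gt /(_ _ g20); rewrite near_withinE => /nbhs_ballP[r' /= r'0 r'P].
have g1pos s : 0 < s -> s < r' -> 0 < g1 s.
  move=> s0 sr'; have := r'P s; rewrite /ball /= sub0r normrN gtr0_norm//.
  move=> /(_ sr' (lt0r_neq0 s0)); rewrite g10 subr0 addr0 [_%:A]mulr1.
  by rewrite /GRing.scale /= pmulr_rgt0// invr_gt0.
pose s := Num.min r r' / 2.
have m0 : 0 < Num.min r r' by rewrite lt_min r0.
have s0 : 0 < s by rewrite divr_gt0.
have sm : s < Num.min r r' by rewrite gtr_pMr// invf_lt1// ltr1n.
have [sr sr'] : s < r /\ s < r' by move: sm; rewrite lt_min => /andP.
have [|x xI|c] := @MVT R g g1 0 s s0.
- move=> x; rewrite in_itv/= => /andP[x0 xs].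
  by have [|//] := Pr x; rewrite gtr0_norm// (lt_trans xs).
- apply: continuous_in_subspaceT => z; rewrite inE/= in_itv/= => /andP[z0 zs].
  apply: differentiable_continuous; apply/derivable1_diffP.
  by have [|[]//] := Pr z; rewrite ger0_norm// (le_lt_trans zs).
rewrite in_itv/= => /andP[c0 cs] E.
have : g s <= g 0 by have [|//] := Pr s; rewrite gtr0_norm.
rewrite -subr_le0 E subr0 leNgt mulr_gt0//.
by rewrite g1pos// (lt_trans cs).
Unshelve. all: by end_near. Qed.

(** Only values to the left of [c] are compared, so the test applies to a maximum at the last time
    of an interval. *)
Lemma derive_ge0_at_left_max g (a c l : R) :
  a < c -> is_derive c 1 g l -> (forall s, a <= s <= c -> g s <= g c) -> 0 <= l.
Proof.
move=> ac [dg <-] gmax.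
rewrite leNgt; apply/negP => l0.
have : (fun h => h^-1 *: (g (h *: 1 + c) - g c)) @ 0^' --> 'D_1 g c by exact: dg.
move=> /cvgr_lt /(_ _ l0); rewrite near_withinE => /nbhs_ballP[r /= r0 rP].
pose h := Num.min r (c - a) / 2.
have m0 : 0 < Num.min r (c - a) by rewrite lt_min r0 subr_gt0.
have h0 : 0 < h by rewrite divr_gt0.
have hm : h < Num.min r (c - a) by rewrite gtr_pMr// invf_lt1// ltr1n.
have [hr hc] : h < r /\ h < c - a by move: hm; rewrite lt_min => /andP.
have := rP (- h); rewrite /ball /= sub0r opprK gtr0_norm// => /(_ hr).
rewrite oppr_eq0 => /(_ (lt0r_neq0 h0)).
rewrite [_%:A]mulr1 /GRing.scale /= invrN mulNr oppr_lt0 pmulr_rgt0 ?invr_gt0//.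
rewrite subr_gt0 ltNge gmax// ; lra.
Qed.

End OneVariable.

Section Directional.
Context {R : realType} {V : normedModType R}.
Implicit Types (f g : V -> R) (x v w : V).

Lemma is_derive_line f x v (s : R) : derivable f (s *: v + x) v ->
  is_derive s 1 (fun r : R => f (r *: v + x)) ('D_v f (s *: v + x)).
Proof.
have E : (fun h => h^-1 *: (f ((h *: 1 + s) *: v + x) - f (s *: v + x))) =
         (fun h => h^-1 *: (f (h *: v + (s *: v + x)) - f (s *: v + x))).
  by apply/funext => h; rewrite [_%:A]mulr1 scalerDl addrA.
by move=> df; apply: DeriveDef; rewrite /derivable /derive E.
Qed.

Lemma MVT_line f x v (h : R) :
  (forall s : R, 0 <= s <= 1 -> derivable f ((s * h) *: v + x) v) ->
  exists2 s : R, 0 <= s <= 1 &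
    f (h *: v + x) - f x = h * 'D_v f ((s * h) *: v + x).
Proof.
move=> df.
have dg (s : R) : 0 <= s <= 1 -> is_derive s (1 : R) (fun r : R => f ((r * h) *: v + x))
    ('D_v f ((s * h) *: v + x) * h).
  move=> /df sI.
  have := @is_derive1_comp _ (fun r : R => f (r *: v + x)) (fun r => r * h) s _ h
    (is_derive_line sI).
  apply.
  rewrite (_ : (fun r => _) = h \*: id); last first.
    by apply/funext => r /=; rewrite mulrC.
  by apply: is_derive_eq; rewrite [_%:A]mulr1.
have [|s|s sI] := @MVT_segment R (fun r : R => f ((r * h) *: v + x))
   (fun s => 'D_v f ((s * h) *: v + x) * h) 0 1 ler01.
- by move=> s; rewrite in_itv /= => /andP[? ?]; apply: dg; rewrite !ltW.
- apply: continuous_in_subspaceT => z; rewrite inE/= in_itv/= => zI.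
  apply: differentiable_continuous; apply/derivable1_diffP.
  by case: (dg z zI).
rewrite mul1r mul0r scale0r add0r subr0 mulr1 => ->.
by exists s; [move: sI; rewrite in_itv|rewrite mulrC].
Qed.

(** The mean value theorem on the segment from [a + x] to [h *: v + (a + x)], whose points all stay
    near [x]. The estimate is uniform in the base point [a + x], which allows increments in
    different directions to be chained. *)
Lemma strict_derive f x v :
  (\forall z \near x, derivable f z v) -> {for x, continuous ('D_v f)} ->
  forall e : R, 0 < e -> exists2 d : R, 0 < d & forall a (h : R), `|a| < d -> `|h| < d ->
    `| f (h *: v + (a + x)) - f (a + x) - h * 'D_v f x | <= e * `|h|.
Proof.
move=> df cf e e0.
have : \forall z \near x, derivable f z v /\ `|'D_v f x - 'D_v f z| < e.
  near=> z; split; first by near: z.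
  near: z; have /cvgrPdist_lt := cf; exact.
move=> /nbhs_ballP[r /= r0 rP].
pose d := r / (1 + `|v|).
have v0 : 0 < 1 + `|v| by rewrite ltr_pwDl.
exists d; first by rewrite divr_gt0.
move=> a h ad hd.
have H (s : R) : 0 <= s <= 1 -> ball x r ((s * h) *: v + (a + x)).
  move=> /andP[s0 s1]; rewrite -ball_normE /ball_ /=.
  rewrite addrA opprD addrCA subrr addr0 normrN.
  rewrite (le_lt_trans (ler_normD _ _))// normrZ normrM (ger0_norm s0).
  rewrite (@le_lt_trans _ _ (`|h| * `|v| + `|a|))//.
    by rewrite lerD2r ler_wpM2r// ler_piMl.
  rewrite (@le_lt_trans _ _ (d * `|v| + `|a|))//.
    by rewrite lerD2r ler_wpM2r// ltW.
  suff -> : r = d * `|v| + d by rewrite ltrD2l.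
  by rewrite -{2}[d]mulr1 -mulrDr [_ + 1]addrC /d divfK// lt0r_neq0.
have [|s sI ->] := @MVT_line f (a + x) v h.
  by move=> s /H /rP[].
rewrite -mulrBr normrM mulrC ler_wpM2r//.
by rewrite distrC ltW//; case: (rP _ (H _ sI)).
Unshelve. all: by end_near. Qed.

End Directional.

(** * Linearity in the direction and symmetry of second derivatives, from continuity of iterated
    directional derivatives *)

Section IteratedDerivatives.
Context {R : realType} {V : normedModType R}.
Implicit Types (f g : V -> R) (x v w p q : V) (A : set V).

Lemma iterD_rcons f (vs : seq V) v : Defs.iterD f (rcons vs v) = Defs.iterD ('D_v f) vs.
Proof. by elim: vs => //= w vs ->. Qed.

Lemma Ck_on_le k m f A : (k <= m)%N -> Ck_on m f A -> Ck_on k f A.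
Proof.
by move=> km [oA H]; split=> // vs vsk; apply: H; exact: leq_trans km.
Qed.

Lemma Ck_on_continuous k f A x : Ck_on k f A -> A x -> {for x, continuous f}.
Proof. by move=> [_ H] Ax; have [] := H [::] isT x Ax. Qed.

Lemma Ck_on_derivable k f A x v : Ck_on k.+1 f A -> A x -> derivable f x v.
Proof. by move=> [_ H] Ax; have [] := H [:: v] isT x Ax. Qed.

Lemma Ck_on_derive k f A v : Ck_on k.+1 f A -> Ck_on k ('D_v f) A.
Proof.
move=> [oA H]; split=> // vs vsk x Ax.
have := H (rcons vs v); rewrite size_rcons => /(_ vsk x Ax) [dvs cvs].
split; last by rewrite -iterD_rcons.
by case: vs vsk dvs {cvs} => //= w vs _; rewrite iterD_rcons.
Qed.

Lemma Ck_on_strict_derive f A x v (e : R) : Ck_on 1 f A -> A x -> 0 < e ->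
  exists2 d : R, 0 < d & forall a (h : R), `|a| < d -> `|h| < d ->
    `| f (h *: v + (a + x)) - f (a + x) - h * 'D_v f x | <= e * `|h|.
Proof.
move=> fA Ax; apply: strict_derive.
  have [oA _] := fA.
  by near=> z; apply: Ck_on_derivable fA _; near: z; exact: open_nbhs_nbhs.
by apply: Ck_on_continuous Ax; exact: Ck_on_derive fA.
Unshelve. all: by end_near. Qed.

(** The path to [h *: (v + w) + x] is split into a step along [v] from [x] and a step along [w] from
    [h *: v + x]; the second needs the strict form of differentiability. *)
Lemma deriveDdir f A x v w : Ck_on 1 f A -> A x ->
  'D_(v + w) f x = 'D_v f x + 'D_w f x.
Proof.
move=> fA Ax; apply: cvg_lim => //; apply/cvgrPdist_le => e e0.
have e2 : 0 < e / 2 by rewrite divr_gt0.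
have [d d0 dP] := @Ck_on_strict_derive f A x w (e / 2) fA Ax e2.
have [d' d'0 d'P] := @Ck_on_strict_derive f A x v (e / 2) fA Ax e2.
have v1 : 0 < 1 + `|v| by rewrite ltr_pwDl.
pose r := Num.min d' (d / (1 + `|v|)).
have r0 : 0 < r by rewrite lt_min d'0 divr_gt0.
rewrite near_withinE; apply/nbhs_ballP; exists r => //= h.
rewrite /ball /= sub0r normrN lt_min ltr_pdivlMr// => /andP[hd' hd] h0.
have hv : `|h *: v| < d.
  by rewrite normrZ (le_lt_trans _ hd)// ler_wpM2l// lerDr.
have {}hd : `|h| < d by rewrite (le_lt_trans _ hd)// ler_peMr// lerDl.
have H1 := dP (h *: v) h hv hd.
have H2 := d'P 0 h; rewrite normr0 add0r in H2.
have {}H2 := H2 d'0 hd'.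
rewrite [h *: (v + w)]scalerDr [h *: v + _]addrC -[h *: w + _ + x]addrA.
have hn0 : 0 < `|h| by rewrite normr_gt0.
rewrite -(ler_pM2l hn0) -normrM. rewrite mulrBr.
rewrite /GRing.scale /= mulrA divff// mul1r.
apply: le_trans (_ : `|h| * (e / 2) + `|h| * (e / 2) <= _); last first.
  by rewrite -mulrDr -splitr.
rewrite ![`|h| * (e / 2)]mulrC.
apply: le_trans (lerD H1 H2); apply: le_trans (ler_normD _ _).
rewrite -normrN le_eqVlt; apply/orP; left; apply/eqP; congr `|_|; ring.
Qed.

Lemma deriveZdir f x v (a : R) : derivable f x v ->
  'D_(a *: v) f x = a * 'D_v f x.
Proof.
move=> df.
have H : is_derive (a * 0) (1 : R) (fun r : R => f (r *: v + x)) ('D_v f x).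
  have := @is_derive_line R V f x v 0.
  by rewrite mulr0 scale0r add0r; apply.
have K : is_derive (0 : R) (1 : R) (fun r : R => a * r) a.
  rewrite (_ : (fun r => _) = a \*: id); last exact/funext.
  by apply: is_derive_eq; rewrite [_%:A]mulr1.
rewrite mulrC -(@derive_val _ _ _ _ _ _ _ (is_derive1_comp H K)) /derive.
apply: (congr1 (fun g : R -> R => lim (g @ 0^'))); apply/funext => h /=.
by rewrite addr0 mulr0 scale0r add0r [_%:A]mulr1 scalerA [a * h]mulrC.
Qed.

Lemma derive_dir_sum f A x m (a : 'I_m -> R) (b : 'I_m -> V) :
  Ck_on 1 f A -> A x ->
  'D_(\sum_i a i *: b i) f x = \sum_i a i * 'D_(b i) f x.
Proof.
move=> fA Ax.
rewrite (@big_morph _ _ (fun v => 'D_v f x) 0 +%R 0 +%R); last 2 first.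
- by move=> v w; apply: deriveDdir fA Ax.
- by rewrite derive0.
by apply: eq_bigr => i _; apply: deriveZdir; apply: Ck_on_derivable fA Ax.
Qed.

Lemma derive2_dir_sum f A x m (a a' : 'I_m -> R) (b b' : 'I_m -> V) :
  Ck_on 2 f A -> A x ->
  'D_(\sum_i a i *: b i) ('D_(\sum_j a' j *: b' j) f) x =
  \sum_i \sum_j a i * a' j * 'D_(b i) ('D_(b' j) f) x.
Proof.
move=> fA Ax; have f1A : Ck_on 1 f A by apply: Ck_on_le fA.
have -> : 'D_(\sum_i a i *: b i) ('D_(\sum_j a' j *: b' j) f) x =
          'D_(\sum_i a i *: b i) (\sum_j a' j *: 'D_(b' j) f) x.
  apply: near_eq_derive; have [oA _] := fA.
  near=> z; rewrite (@derive_dir_sum f A)//; last by near: z; exact: open_nbhs_nbhs.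
  by rewrite fct_sumE; apply: eq_bigr => j _.
have dA j v : derivable (a' j *: 'D_(b' j) f) x v.
  by apply: derivableZ; apply: Ck_on_derivable Ax; apply: Ck_on_derive fA.
rewrite derive_sum; last by move=> j; exact: dA.
rewrite exchange_big /=; apply: eq_bigr => j _.
have djA : Ck_on 1 ('D_(b' j) f) A by exact: Ck_on_derive fA.
rewrite deriveZ; last exact: Ck_on_derivable djA Ax.
rewrite (@derive_dir_sum _ A)// /GRing.scale /= mulr_sumr.
by apply: eq_bigr => i _; rewrite mulrCA mulrA.
Unshelve. all: by end_near. Qed.

(** The second difference is the increment along [p] of z |-> f(z + hq) - f(z). The mean value
    theorem turns it into h times an increment of ['D_p f] along [q], based at a point moved by at
    most h|p|, and strict differentiability of ['D_p f] finishes. *)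
Lemma second_difference f A x p q (e : R) : Ck_on 2 f A -> A x -> 0 < e ->
  exists2 d : R, 0 < d & forall h : R, 0 < h < d ->
    `| f (h *: p + h *: q + x) - f (h *: p + x) - f (h *: q + x) + f x
       - h ^+ 2 * 'D_q ('D_p f) x | <= e * h ^+ 2.
Proof.
move=> fA Ax e0; have f1A : Ck_on 1 f A by apply: Ck_on_le fA.
have g1A := Ck_on_derive p fA.
have [d d0 dP] := Ck_on_strict_derive q g1A Ax e0.
have [oA _] := fA.
have /nbhs_ballP[r /= r0 rA] : nbhs x A by exact: open_nbhs_nbhs.
(* Dividing the radius by [c] keeps the whole parallelogram spanned by hp and hq inside the ball. *)
pose c := 1 + `|p| + `|q|.
have c1 : 1 <= c by rewrite /c -addrA lerDl addr_ge0.
have c0 : 0 < c by rewrite (lt_le_trans _ c1).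
have dr0 : 0 < Num.min d r by rewrite lt_min d0.
exists (Num.min d r / c); first by rewrite divr_gt0.
move=> h /andP[h0]; rewrite ltr_pdivlMr// lt_min => /andP[hd hr].
have H (s : R) : 0 <= s <= 1 -> `|(s * h) *: p| <= h * `|p|.
  move=> /andP[s0 s1]; rewrite normrZ normrM (ger0_norm s0) (gtr0_norm h0).
  by rewrite -mulrA ler_piMl// mulr_ge0// ltW.
have hc : h * `|p| + h * `|q| <= h * c.
  by rewrite -mulrDr ler_pM2l// /c -addrA lerDr.
have hp : h * `|p| <= h * c by rewrite (le_trans _ hc)// lerDl mulr_ge0// ltW.
have A0 (s : R) : 0 <= s <= 1 -> A ((s * h) *: p + x).
  move=> sI; apply: rA; rewrite -ball_normE /ball_ /=.
  by rewrite opprD addrCA subrr addr0 normrN (le_lt_trans (H _ sI))// (le_lt_trans hp).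
have A1 (s : R) : 0 <= s <= 1 -> A (h *: q + ((s * h) *: p + x)).
  move=> sI; apply: rA; rewrite -ball_normE /ball_ /=.
  rewrite addrA opprD addrCA subrr addr0 normrN (le_lt_trans (ler_normD _ _))//.
  rewrite (le_lt_trans _ hr)// (le_trans _ hc)// addrC lerD ?H//.
  by rewrite normrZ gtr0_norm.
pose g z := f (h *: q + z) - f z.
have shiftE z : (fun k : R => k^-1 *: (f (h *: q + (k *: p + z)) - f (h *: q + z))) =
    (fun k => k^-1 *: (f (k *: p + (h *: q + z)) - f (h *: q + z))).
  by apply/funext => k; rewrite addrCA.
have dg (s : R) : 0 <= s <= 1 -> is_derive ((s * h) *: p + x) p g
    ('D_p f (h *: q + ((s * h) *: p + x)) - 'D_p f ((s * h) *: p + x)).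
  move=> sI.
  have fd : is_derive ((s * h) *: p + x) p (fun z => f (h *: q + z))
      ('D_p f (h *: q + ((s * h) *: p + x))).
    have := @Ck_on_derivable 0 _ _ _ p f1A (A1 _ sI).
    by move=> df; apply: DeriveDef; rewrite /derivable /derive shiftE.
  apply: is_deriveB => //; apply: derivableP.
  exact: Ck_on_derivable f1A (A0 _ sI).
have [|s sI] := @MVT_line R V g x p h.
  by move=> s sI; have [] := dg _ sI.
have [_ ->] := dg _ sI.
rewrite /g => gE.
rewrite [h *: p + h *: q]addrC -[h *: q + h *: p + x]addrA.
rewrite (_ : _ + f x = (f (h *: q + (h *: p + x)) - f (h *: p + x)) -
   (f (h *: q + x) - f x)); last by ring.
rewrite gE expr2 -mulrA -mulrBr normrM (gtr0_norm h0) mulrCA ler_pM2l//.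
have := dP ((s * h) *: p) h; rewrite (gtr0_norm h0); apply.
  by rewrite (le_lt_trans (H _ sI))// (le_lt_trans hp).
by rewrite (le_lt_trans _ hd)// ler_peMr// ltW.
Qed.

(** The second difference is symmetric in [p] and [q], so both mixed derivatives are the limit of
    the same quotient. *)
Lemma derive_comm f A x p q : Ck_on 2 f A -> A x ->
  'D_p ('D_q f) x = 'D_q ('D_p f) x.
Proof.
move=> fA Ax; apply/eqP; rewrite -subr_eq0 -normr_le0.
apply/ler_addgt0Pl => e e0; rewrite addr0.
have e2 : 0 < e / 2 by rewrite divr_gt0.
have [d d0 dP] := second_difference p q fA Ax e2.
have [d' d'0 d'P] := second_difference q p fA Ax e2.
pose h := Num.min d d' / 2.
have m0 : 0 < Num.min d d' by rewrite lt_min d0.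
have h0 : 0 < h by rewrite divr_gt0.
have hm : h < Num.min d d' by rewrite gtr_pMr// invf_lt1// ltr1n.
move: hm; rewrite lt_min => /andP[hd hd'].
have h20 : 0 < h ^+ 2 by rewrite exprn_gt0.
have := dP h; rewrite h0 hd => /(_ isT) H1.
have := d'P h; rewrite h0 hd' => /(_ isT) H2.
rewrite -(ler_pM2r h20) -[X in _ * X]gtr0_norm// -normrM.
apply: le_trans (_ : e / 2 * h ^+ 2 + e / 2 * h ^+ 2 <= _); last first.
  by rewrite -mulrDl -splitr.
apply: le_trans (lerD H1 H2); apply: le_trans (ler_normB _ _).
rewrite [h *: q + h *: p]addrC le_eqVlt; apply/orP; left; apply/eqP.
congr `|_|.
move: (f (h *: p + h *: q + x)) (f (h *: p + x)) (f (h *: q + x)) (f x)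
  ('D_p ('D_q f) x) ('D_q ('D_p f) x) => f1 f2 f3 f4 f5 f6; ring.
Qed.

End IteratedDerivatives.

(** * Euclidean geometry of row vectors *)

Section Dot.
Context {R : realType} {m : nat}.
Implicit Types v w x : 'rV[R]_m.

Definition dot v w : R := \sum_i v 0 i * w 0 i.
Definition nsq v : R := dot v v.

Lemma dotC v w : dot v w = dot w v.
Proof. by apply: eq_bigr => i _; rewrite mulrC. Qed.

Lemma dotDl v w x : dot (v + w) x = dot v x + dot w x.
Proof. by rewrite -big_split; apply: eq_bigr => i _; rewrite mxE mulrDl. Qed.

Lemma dotZl a v x : dot (a *: v) x = a * dot v x.
Proof. by rewrite mulr_sumr; apply: eq_bigr => i _; rewrite mxE mulrA. Qed.

Lemma dotDr v w x : dot x (v + w) = dot x v + dot x w.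
Proof. by rewrite !(dotC x) dotDl. Qed.

Lemma dotZr a v x : dot x (a *: v) = a * dot x v.
Proof. by rewrite !(dotC x) dotZl. Qed.

Lemma nsq_ge0 v : 0 <= nsq v.
Proof. by apply: sumr_ge0 => i _; rewrite -expr2 sqr_ge0. Qed.

Lemma coord_sq_le_nsq v i : v 0 i ^+ 2 <= nsq v.
Proof.
rewrite /nsq /dot (bigD1 i)//= -expr2 lerDl.
by apply: sumr_ge0 => j _; rewrite -expr2 sqr_ge0.
Qed.

Lemma nsq_eq0 v : (nsq v == 0) = (v == 0).
Proof.
apply/eqP/eqP => [v0|->]; last by rewrite /nsq /dot big1// => i _; rewrite mxE mul0r.
apply/rowP => i; rewrite mxE; apply/eqP; rewrite -sqrf_eq0 eq_le sqr_ge0 andbT.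
by rewrite -v0 coord_sq_le_nsq.
Qed.

Lemma nsq_gt0 v : (0 < nsq v) = (v != 0).
Proof. by rewrite lt_def nsq_eq0 nsq_ge0 andbT. Qed.

Lemma nsqZ a v : nsq (a *: v) = a ^+ 2 * nsq v.
Proof. by rewrite /nsq dotZl dotZr mulrA. Qed.

Lemma nsqD v w : nsq (v + w) = nsq v + 2 * dot v w + nsq w.
Proof. rewrite /nsq !dotDl !dotDr (dotC w v); ring. Qed.

Lemma dot_sq_le v w : dot v w ^+ 2 <= nsq v * nsq w.
Proof.
have [->|w0] := eqVneq w 0.
  by rewrite /dot big1 ?expr0n ?mulr_ge0 ?nsq_ge0// => i _; rewrite mxE mulr0.
have w1 : 0 < nsq w by rewrite nsq_gt0.
have := nsq_ge0 (nsq w *: v + (- dot v w) *: w).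
rewrite nsqD !nsqZ dotZl dotZr -/(nsq w).
rewrite (_ : _ + _ = nsq w * (nsq v * nsq w - dot v w ^+ 2)); last by ring.
by rewrite pmulr_rge0// subr_ge0.
Qed.

Lemma rV_norm_le (M : R) v : 0 <= M -> (forall j, `|v 0 j| <= M) -> `|v| <= M.
Proof.
move=> M0 vM; rewrite [leLHS]/Num.norm /= mx_normrE; apply/bigmax_leP; split => //.
by move=> [i j] _ /=; rewrite ord1.
Qed.

Lemma cvg_sum_ord (T : Type) (G : set_system T) k (f : 'I_k -> T -> R) (l : 'I_k -> R) :
  Filter G -> (forall i, f i x @[x --> G] --> l i) ->
  \sum_i f i x @[x --> G] --> \sum_i l i.
Proof.
by move=> FG fl; apply: cvg_big => //; exact: add_continuous.
Qed.

Lemma dot_continuous : continuous (fun z : 'rV[R]_m * 'rV[R]_m => dot z.1 z.2).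
Proof.
move=> z; apply: cvg_sum_ord => i; apply: cvgM.
  by apply: (@cvg_comp _ _ _ fst (fun M : 'rV[R]_m => M 0 i));
    [exact: cvg_fst|exact: coord_continuous].
by apply: (@cvg_comp _ _ _ snd (fun M : 'rV[R]_m => M 0 i));
  [exact: cvg_snd|exact: coord_continuous].
Qed.

Lemma nsq_continuous : continuous (nsq : 'rV[R]_m -> R).
Proof.
move=> z; apply: (@cvg_sum_ord _ (nbhs z) m (fun i v => v 0 i * v 0 i)) => i.
by apply: cvgM; exact: coord_continuous.
Qed.

Definition unit_sphere : set 'rV[R]_m := [set v | nsq v = 1].

Lemma unit_sphere_neq0 v : unit_sphere v -> v != 0.
Proof. by rewrite /unit_sphere /= => v1; rewrite -nsq_gt0 v1. Qed.

Lemma compact_unit_sphere : compact unit_sphere.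
Proof.
apply: bounded_closed_compact; last first.
  have /continuous_closedP cl := nsq_continuous.
  exact: (cl _ (@closed_eq _ (1 : R))).
exists 1; split; first exact: num_real.
move=> M M1 v /= v1; apply: rV_norm_le; first by rewrite ltW// (lt_trans _ M1).
move=> j; rewrite (le_trans _ (ltW M1))//.
by rewrite -(@expr_le1 _ 2)// real_normK ?num_real// -v1 coord_sq_le_nsq.
Qed.

End Dot.

(** * Ellipticity of the anisotropy *)

Section Homogeneous.
Context {R : realType} {V : normedModType R}.
Implicit Types (f : V -> R) (x p : V).

(** Serves both orders of differentiation: c = l for [F], homogeneous of degree one, and c = 1 for
    its first derivatives, homogeneous of degree zero. *)
Lemma derive_scaled f x p (l c : R) : l != 0 ->
  (\forall z \near x, f (l *: z) = c * f z) ->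
  derivable f x p -> derivable f (l *: x) p ->
  'D_p f (l *: x) = l^-1 * c * 'D_p f x.
Proof.
move=> l0 fl fx flx.
have H : 'D_(l *: p) f (l *: x) = c * 'D_p f x.
  have -> : 'D_(l *: p) f (l *: x) = 'D_p (fun z => f (l *: z)) x.
    rewrite /derive; apply: (congr1 (fun g : R -> R => lim (g @ 0^'))).
    by apply/funext => h /=; rewrite [l *: (_ + _)]scalerDr !scalerA [h * l]mulrC.
  by rewrite (@near_eq_derive _ _ _ _ (c \*: f))// deriveZ.
by rewrite -mulrA -H deriveZdir// mulKf.
Qed.

Lemma derive_ray f x (c : R) :
  (\forall h \near (0 : R), f (h *: x + x) = f x + h * c) -> 'D_x f x = c.
Proof.
move=> fh; apply: cvg_lim => //; apply/cvgrPdist_le => e e0.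
rewrite near_withinE; move: fh; apply: filterS => h fh h0.
by rewrite /= fh addrAC subrr add0r /GRing.scale /= mulKf// subrr normr0 ltW.
Qed.

End Homogeneous.

Section Anisotropy.
Context {R : realType} {m : nat} (F : 'rV[R]_m -> R).
Implicit Types (nu v p q : 'rV[R]_m).
Hypothesis Fpos : forall v, v != 0 -> 0 < F v.
Hypothesis Fhom : forall (l : R) v, 0 < l -> F (l *: v) = l * F v.
Hypothesis FC2 : Ck_on 2 F (~` [set 0]).
Hypothesis Fcvx : forall nu p, nu != 0 -> p != 0 -> 'D_p F nu = 0 ->
  0 < 'D_p ('D_p F) nu.

Local Notation H nu p q := ('D_p ('D_q F) nu).

Let in_dom nu : nu != 0 -> (~` [set 0]) nu. Proof. by move/eqP. Qed.

Let FC1 : Ck_on 1 F (~` [set 0]). Proof. exact: Ck_on_le FC2. Qed.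

Let near_pos : \forall h \near (0 : R), 0 < h + 1.
Proof.
near=> h; have : `|h| < 1.
  near: h; apply/nbhs_ballP; exists 1 => //= h.
  by rewrite /ball /= sub0r normrN.
by rewrite ltr_norml; lra.
Unshelve. all: by end_near. Qed.

Lemma derivable_hom nu p : nu != 0 -> derivable F nu p.
Proof. by move=> nu0; apply: Ck_on_derivable FC1 _; exact: in_dom. Qed.

Lemma derivable2_hom nu p q : nu != 0 -> derivable ('D_q F) nu p.
Proof.
by move=> nu0; apply: Ck_on_derivable (Ck_on_derive q FC2) _; exact: in_dom.
Qed.

Lemma euler_hom nu : 'D_nu F nu = F nu.
Proof.
apply: derive_ray; near=> h.
have -> : h *: nu + nu = (h + 1) *: nu by rewrite scalerDl scale1r.
rewrite Fhom ?mulrDl ?mul1r; last by near: h.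
by rewrite addrC.
Unshelve. all: by end_near. Qed.

Lemma derive_hom_scale nu p (l : R) : nu != 0 -> 0 < l ->
  'D_p F (l *: nu) = 'D_p F nu.
Proof.
move=> nu0 l0; have ln0 := lt0r_neq0 l0.
rewrite (@derive_scaled _ _ _ _ _ _ l)// ?mulVf// ?mul1r//.
- by near=> z; rewrite Fhom.
- exact: derivable_hom.
- by apply: derivable_hom; rewrite scaler_eq0 negb_or ln0.
Unshelve. all: by end_near. Qed.

Lemma derive2_hom_scale nu p q (l : R) : nu != 0 -> 0 < l ->
  H (l *: nu) p q = l^-1 * H nu p q.
Proof.
move=> nu0 l0; have ln0 := lt0r_neq0 l0.
rewrite (@derive_scaled _ _ _ _ _ _ 1)// ?mulr1//.
- have : nbhs nu (~` [set 0]).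
    by apply: open_nbhs_nbhs; split; [have [] := FC2|exact: in_dom].
  by apply: filterS => z /eqP z0; rewrite derive_hom_scale ?mul1r.
- exact: derivable2_hom.
- by apply: derivable2_hom; rewrite scaler_eq0 negb_or ln0.
Qed.

(** First derivatives of [F] are constant along rays. *)
Lemma derive2_hom_radial nu q : nu != 0 -> H nu nu q = 0.
Proof.
move=> nu0; apply: derive_ray; near=> h.
have -> : h *: nu + nu = (h + 1) *: nu by rewrite scalerDl scale1r.
by rewrite mulr0 addr0 derive_hom_scale//; near: h.
Unshelve. all: by end_near. Qed.

Lemma derive2_hom_sub nu p (a : R) : nu != 0 ->
  H nu (p - a *: nu) (p - a *: nu) = H nu p p.
Proof.
move=> nu0; have nuA := in_dom nu0.
have L w v : H nu (v - a *: nu) w = H nu v w.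
  have w1 := Ck_on_derive w FC2.
  rewrite -scaleNr (deriveDdir _ _ w1)// deriveZdir; last exact: derivable2_hom.
  by rewrite derive2_hom_radial// mulr0 addr0.
by rewrite L (derive_comm _ _ FC2)// L.
Qed.

(** The Hessian ignores radial components. By Euler's relation, subtracting ['D_p F nu / F nu] times
    [nu] makes [p] tangent to the level set, where convexity applies; the result is nonzero because
    [p] is not radial. *)
Lemma derive2_hom_gt0 nu p : nu != 0 -> (forall a : R, p != a *: nu) ->
  0 < H nu p p.
Proof.
move=> nu0 pnu; rewrite -(@derive2_hom_sub nu p ('D_p F nu / F nu))//.
apply: Fcvx => //; first by rewrite subr_eq0.
rewrite -scaleNr (deriveDdir _ _ FC1); last exact: in_dom.
rewrite deriveZdir; last exact: derivable_hom.
by rewrite euler_hom mulNr divfK ?subrr// lt0r_neq0// Fpos.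
Qed.

Lemma derive2_hom_coord nu p q : nu != 0 ->
  H nu p q = \sum_i \sum_j p 0 i * q 0 j * H nu (delta_mx 0 i) (delta_mx 0 j).
Proof.
by move=> nu0; rewrite {1}(row_sum_delta p) {1}(row_sum_delta q)
  (derive2_dir_sum _ _ _ _ FC2)//; exact: in_dom.
Qed.

Lemma derive2_homZ nu p (a : R) : nu != 0 ->
  H nu (a *: p) (a *: p) = a ^+ 2 * H nu p p.
Proof.
move=> nu0; rewrite !(derive2_hom_coord _ _ nu0) mulr_sumr.
apply: eq_bigr => i _; rewrite mulr_sumr; apply: eq_bigr => j _.
by rewrite !mxE; ring.
Qed.


Let normalize nu : nu != 0 ->
  exists2 w, unit_sphere w & nu = Num.sqrt (nsq nu) *: w.
Proof.
move=> nu0; have N0 : 0 < nsq nu by rewrite nsq_gt0.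
have r0 : Num.sqrt (nsq nu) != 0 by rewrite lt0r_neq0// sqrtr_gt0.
exists ((Num.sqrt (nsq nu))^-1 *: nu); last by rewrite scalerA divff// scale1r.
by rewrite /unit_sphere /= nsqZ exprVn sqr_sqrtr ?ltW// mulVf// lt0r_neq0.
Qed.

Lemma anisotropy_le_norm :
  exists2 C : R, 0 < C & forall nu, nu != 0 -> F nu <= C * Num.sqrt (nsq nu).
Proof.
have [[w0 w0S]|S0] := pselect (exists w : 'rV[R]_m, unit_sphere w); last first.
  by exists 1 => // nu /normalize[w wS _]; case: S0; exists w.
have [||w wS wmax] := @compact_EVT_max _ R F unit_sphere _ (@compact_unit_sphere R m).
- by exists w0.
- apply: continuous_in_subspaceT => v; rewrite inE => /unit_sphere_neq0 v0.
  by apply: (Ck_on_continuous FC2); exact: in_dom.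
rewrite inE in wS; exists (F w); first exact: Fpos (unit_sphere_neq0 wS).
move=> nu nu0; have [v vS nuE] := normalize nu0.
rewrite {1}nuE Fhom ?sqrtr_gt0 ?nsq_gt0// mulrC ler_wpM2r ?sqrtr_ge0//.
by apply: wmax; rewrite inE.
Qed.

(** The minimum over the compact set of orthonormal pairs is positive, since a unit vector
    orthogonal to [w] is not a multiple of [w]. *)
Let coercive_sphere : exists2 c : R, 0 < c & forall w v,
  unit_sphere w -> unit_sphere v -> dot w v = 0 -> c <= F w * H w v v.
Proof.
pose A : set ('rV[R]_m * 'rV[R]_m) :=
  (unit_sphere `*` unit_sphere) `&` [set z | dot z.1 z.2 = 0].
have [[z0 z0A]|A0] := pselect (exists z, A z); last first.
  by exists 1 => // w v wS vS wv; case: A0; exists (w, v).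
(* Expanded in coordinates, the form is visibly continuous in base point and direction jointly. *)
pose G (z : 'rV[R]_m * 'rV[R]_m) :=
  F z.1 * \sum_i \sum_j z.2 0 i * z.2 0 j * H z.1 (delta_mx 0 i) (delta_mx 0 j).
have GE w v : unit_sphere w -> F w * H w v v = G (w, v).
  by move=> /unit_sphere_neq0 w0; rewrite [H w v v]derive2_hom_coord.
have [|||[w v] wvA wvmin] := @compact_EVT_min _ R G A.
- by exists z0.
- apply: compact_closedI; first by apply: compact_setX; exact: compact_unit_sphere.
  have /continuous_closedP cl := @dot_continuous R m.
  exact: (cl _ (@closed_eq _ (0 : R))).
- apply: continuous_in_subspaceT => z; rewrite inE => -[[/unit_sphere_neq0 z1 _] _].
  have cS (f : 'rV[R]_m -> R) k : Ck_on k f (~` [set 0]) -> f y.1 @[y --> z] --> f z.1.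
    move=> fC; apply: (@cvg_comp _ _ _ fst f); first exact: cvg_fst.
    by apply: (Ck_on_continuous fC); exact: in_dom.
  have c2 (i : 'I_m) : (fun y : 'rV[R]_m * 'rV[R]_m => y.2 0 i) y @[y --> z] --> z.2 0 i.
    by apply: (@cvg_comp _ _ _ snd (fun M : 'rV[R]_m => M 0 i));
      [exact: cvg_snd|exact: coord_continuous].
  apply: cvgM; first exact: cS FC2.
  apply: cvg_sum_ord => i; apply: cvg_sum_ord => j.
  apply: cvgM; first exact: cvgM.
  apply: (cS (fun w => H w (delta_mx 0 i) (delta_mx 0 j))).
  exact: Ck_on_derive (Ck_on_derive _ FC2).
move: wvA; rewrite inE => -[[/= wS vS] wv0].
have w0 := unit_sphere_neq0 wS.
exists (G (w, v)); last first.
  move=> w' v' w'S v'S w'v'; rewrite (GE _ _ w'S).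
  have wvA' : (w', v') \in A by rewrite inE.
  exact: wvmin wvA'.
rewrite -GE// mulr_gt0// ?Fpos// derive2_hom_gt0// => a; apply/eqP => vE.
move: wv0; rewrite /= vE dotZr -/(nsq w) wS mulr1 => a0.
by move: (unit_sphere_neq0 vS); rewrite vE a0 scale0r eqxx.
Qed.

(** The bracket on the left is |s|^2 |nu|^2 with s the part of [v] orthogonal to [nu], and replacing
    [v] by s does not change the Hessian form. Since F D^2F is homogeneous of degree zero in [nu],
    everything reduces to orthonormal pairs. *)
Lemma anisotropy_coercive : exists2 c : R, 0 < c & forall nu v, nu != 0 ->
  c * (nsq v * nsq nu - dot v nu ^+ 2) <= F nu * H nu v v * nsq nu.
Proof.
have [c c0 cP] := coercive_sphere; exists c => // nu v nu0.
have N0 : 0 < nsq nu by rewrite nsq_gt0.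
have Nn0 := lt0r_neq0 N0.
pose s := v - (dot v nu / nsq nu) *: nu.
have snu : dot s nu = 0.
  by rewrite /s -scaleNr dotDl dotZl -/(nsq nu) mulNr divfK// subrr.
have -> : nsq v * nsq nu - dot v nu ^+ 2 = nsq s * nsq nu.
  by rewrite /s -[- (_ *: nu)]scaleNr (nsqD v) nsqZ dotZr; field.
rewrite -(derive2_hom_sub v (dot v nu / nsq nu) nu0) -/s mulrA ler_pM2r//.
have [s0|s0] := eqVneq s 0.
  have -> : nsq s = 0 by apply/eqP; rewrite nsq_eq0 s0.
  have -> : s = 0 *: s by rewrite scale0r.
  by rewrite derive2_homZ// expr0n mul0r !mulr0.
have [w wS nuE] := normalize nu0; have [x xS sE] := normalize s0.
have w0 := unit_sphere_neq0 wS.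
have r0 : 0 < Num.sqrt (nsq nu) by rewrite sqrtr_gt0.
have t0 : 0 < Num.sqrt (nsq s) by rewrite sqrtr_gt0 nsq_gt0.
have wx : dot w x = 0.
  apply/eqP; move/eqP: snu; rewrite nuE sE dotZl dotZr !mulf_eq0.
  by rewrite (gt_eqF r0) (gt_eqF t0)/= dotC.
have -> : F nu * H nu s s = nsq s * (F w * H w x x).
  have -> : F nu = Num.sqrt (nsq nu) * F w by rewrite {1}nuE Fhom.
  have -> : H nu s s = (Num.sqrt (nsq nu))^-1 * (nsq s * H w x x).
    rewrite {1}nuE derive2_hom_scale// {1 2}sE derive2_homZ//.
    by rewrite sqr_sqrtr// nsq_ge0.
  field; exact: lt0r_neq0.
by rewrite mulrC ler_wpM2l ?nsq_ge0// cP.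
Qed.

End Anisotropy.

(** * The trace of a product of semidefinite forms of opposite sign *)

Section TraceInequality.
Context {R : realType} {n : nat}.
Implicit Types (B D : 'I_n -> 'I_n -> R) (v x : 'I_n -> R).

Definition qform B v : R := \sum_i v i * \sum_j v j * B i j.

Let sum_shift x (Y : 'I_n -> R) (c : R) k :
  \sum_j (x j + c * (j == k)%:R) * Y j = \sum_j x j * Y j + c * Y k.
Proof.
under eq_bigr do rewrite mulrDl.
rewrite big_split /=; congr (_ + _).
rewrite (bigD1 k)//= eqxx mulr1 big1 ?addr0// => j /negbTE ->.
by rewrite mulr0 mul0r.
Qed.

Let qform_shift B v (c : R) k :
  qform B (fun i => v i + c * (i == k)%:R) =
  qform B v + c * (\sum_i v i * B i k) + c * (\sum_j v j * B k j) + c ^+ 2 * B k k.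
Proof.
rewrite /qform sum_shift; under eq_bigr do rewrite sum_shift mulrDr.
rewrite big_split /= sum_shift mulrDr !addrA; congr (_ + _ + _ + _).
  by rewrite mulr_sumr; apply: eq_bigr => i _; rewrite mulrCA.
by rewrite mulrA expr2.
Qed.

Let qform_delta B k : qform B (fun i => (i == k)%:R) = B k k.
Proof.
have := qform_shift B (fun=> 0) 1 k; rewrite /qform.
under eq_bigr do rewrite add0r mul1r.
rewrite [in RHS]big1 => [|i _]; last by rewrite mul0r.
rewrite [in RHS]big1 => [|i _]; last by rewrite mul0r.
rewrite [in RHS]big1 => [|i _]; last by rewrite mul0r.
rewrite !mulr0 !add0r expr1n mul1r => <-; apply: eq_bigr => i _.
by congr (_ * _); apply: eq_bigr => j _; rewrite add0r mul1r.
Qed.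

(** Completing squares one index at a time writes [B] as a sum of squares of linear forms, each of
    which contributes a nonpositive value of [D]. The induction is on a set of indices supporting
    [B], so that no matrix has to be resized. *)
Lemma psd_nsd_trace_le0 B D :
  (forall i j, B i j = B j i) -> (forall v, 0 <= qform B v) ->
  (forall v, qform D v <= 0) -> \sum_i \sum_j B i j * D i j <= 0.
Proof.
move=> symB psdB nsdD.
suff trace N : forall (S : {set 'I_n}) B, (#|S| <= N)%N ->
    (forall i j, i \notin S -> B i j = 0) ->
    (forall i j, B i j = B j i) -> (forall v, 0 <= qform B v) ->
    \sum_i \sum_j B i j * D i j <= 0.
  by apply: (trace #|[set: 'I_n]%SET| [set: 'I_n]%SET) => // i j; rewrite inE.
elim: N => [|N IH] S {symB psdB}B SN supB symB psdB.
  rewrite big1 // => i _; rewrite big1// => j _; rewrite supB ?mul0r//.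
  by move: SN; rewrite leqn0 cards_eq0 => /eqP ->; rewrite inE.
have [S0|[k kS]] := set_0Vmem S.
  by apply: (IH S) => //; rewrite S0 cards0.
have SkN : (#|S :\ k| <= N)%N by move: SN; rewrite (cardsD1 k) kS.
have [b0|b0] := eqVneq (B k k) 0.
  have B0 i : B i k = 0.
    apply/eqP/negPn/negP => Bik.
    (* With a zero pivot the form is affine in the coefficient of the k-th basis vector; this
       coefficient makes its value -1. *)
    have := psdB (fun j => (j == i)%:R + (- (B i i + 1) / (2 * B i k)) * (j == k)%:R).
    rewrite qform_shift qform_delta b0 mulr0 addr0.
    rewrite (_ : \sum_j _ = B i k); last first.
      rewrite (bigD1 i)//= eqxx mul1r big1 ?addr0// => j /negbTE ->.
      by rewrite mul0r.
    rewrite (_ : \sum_j _ = B i k); last first.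
      rewrite (bigD1 i)//= eqxx mul1r big1 ?addr0 1?symB// => j /negbTE ->.
      by rewrite mul0r.
    rewrite (_ : _ + _ = -1); first by lra.
    by field.
  apply: (IH (S :\ k)) => // i j; rewrite !inE negb_and negbK => /orP[/eqP ->|].
    by rewrite symB.
  exact: supB.
pose b := B k k; have b_gt0 : 0 < b by rewrite /b lt_def b0 /= -(qform_delta B k) psdB.
(* The Schur complement of the pivot: it stays semidefinite because its form at v is the minimum of
   the form of [B] over shifts of v along the k-th basis vector. *)
pose B' i j := B i j - B i k * B k j / b.
have : \sum_i \sum_j B' i j * D i j <= 0.
  apply: (IH (S :\ k)) => //.
  - move=> i j; rewrite !inE negb_and negbK /B' => /orP[/eqP ->|iS].
      by rewrite mulrAC divff ?mul1r ?subrr// lt0r_neq0.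
    by rewrite (supB i j iS) (supB i k iS) !mul0r subrr.
  - by move=> i j; rewrite /B' symB (symB i k) (symB k j); congr (_ - _ / _); rewrite mulrC.
  - move=> v; pose c := \sum_i v i * B i k.
    have cE : \sum_j v j * B k j = c by apply: eq_bigr => j _; rewrite symB.
    suff -> : qform B' v = qform B (fun i => v i + (- (c / b)) * (i == k)%:R) by [].
    rewrite qform_shift cE -/c -/b.
    have -> : qform B' v = qform B v - c * c / b.
      rewrite /qform; under eq_bigr => i _.
        rewrite (_ : \sum_j _ = \sum_j v j * B i j - B i k * c / b).
          over.
        rewrite -cE mulr_sumr mulr_suml -sumrB; apply: eq_bigr => j _.
        by rewrite /B'; ring.
      under eq_bigr do rewrite mulrBr.
      rewrite sumrB; congr (_ - _); rewrite -mulrA {1}/c mulr_suml.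
      by apply: eq_bigr => i _; rewrite !mulrA.
    by field; exact: lt0r_neq0.
have : qform D (fun i => B i k) <= 0 by [].
have -> : \sum_i \sum_j B i j * D i j =
   \sum_i \sum_j B' i j * D i j + qform D (fun i => B i k) / b.
  rewrite /qform mulr_suml -big_split; apply: eq_bigr => i _ /=.
  rewrite mulr_sumr mulr_suml -big_split; apply: eq_bigr => j _ /=.
  by rewrite /B' (symB j k); field; exact: lt0r_neq0.
move=> q0 t0; rewrite -[leRHS]addr0 lerD//.
by rewrite mulr_le0_ge0// invr_ge0 ltW.
Qed.

End TraceInequality.

(** * The two-point maximum principle *)

Section Slices.
Context {R : realType} {n : nat}.
Implicit Types (g : 'rV[R]_n * R -> R) (y v : 'rV[R]_n) (t : R).

Let scale_pairD (h b : R) v y t : h *: (v, b) + (y, t) = (h *: v + y, h * b + t).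
Proof. by []. Qed.

Lemma derive_slice g v y t : 'D_v (fun z => g (z, t)) y = 'D_(v, 0) g (y, t).
Proof.
rewrite /derive; apply: (congr1 (fun f : R -> R => lim (f @ 0^'))).
apply/funext => h.
change (h^-1 *: (g (h *: v + y, t) - g (y, t)) =
        h^-1 *: (g (h *: (v, 0 : R) + (y, t)) - g (y, t))).
by rewrite scale_pairD mulr0 add0r.
Qed.

Variables (u : 'rV[R]_n -> R -> R) (U : set ('rV[R]_n * R)).
Hypothesis uC2 : Ck_on 2 (ust u) U.

Definition grad y t : 'rV[R]_n := \row_i u_i u i y t.

Definition hess y t : 'I_n -> 'I_n -> R := fun i j => u_ij u i j y t.

Let uC1 : Ck_on 1 (ust u) U. Proof. exact: Ck_on_le uC2. Qed.

Let u_iE i y t : u_i u i y t = 'D_(e R i, 0) (ust u) (y, t).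
Proof. exact: derive_slice. Qed.

Let u_ijE i j y t :
  u_ij u i j y t = 'D_(e R i, 0) ('D_(e R j, 0) (ust u)) (y, t).
Proof.
rewrite /u_ij (_ : (fun z => _) = (fun z => 'D_(e R j, 0) (ust u) (z, t))).
  exact: derive_slice.
by apply/funext => z; rewrite u_iE.
Qed.

Let pair_sum v : (v, 0) = \sum_i v 0 i *: (e R i, 0) :> 'rV[R]_n * R.
Proof.
rewrite {1}(row_sum_delta v).
have H (s : seq 'I_n) : (\sum_(i <- s) v 0 i *: delta_mx 0 i, 0) =
    \sum_(i <- s) v 0 i *: (e R i, 0 : R) :> 'rV[R]_n * R.
  elim: s => [|i s IH]; first by rewrite !big_nil.
  by rewrite !big_cons -IH scale_pairD mulr0 addr0.
exact: H.
Qed.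

Let D_pair v y t : U (y, t) -> 'D_(v, 0) (ust u) (y, t) = dot (grad y t) v.
Proof.
move=> Uyt; rewrite pair_sum (derive_dir_sum _ _ uC1)//.
by apply: eq_bigr => i _; rewrite mxE mulrC u_iE.
Qed.

Lemma is_derive_slice v y t s : U (s *: v + y, t) ->
  is_derive s (1 : R) (fun r : R => u (r *: v + y) t) (dot (grad (s *: v + y) t) v).
Proof.
have E (r : R) : r *: (v, 0 : R) + (y, t) = (r *: v + y, t).
  by rewrite scale_pairD mulr0 add0r.
move=> Us; rewrite -D_pair//.
have := @is_derive_line _ _ (ust u) (y, t) (v, 0) s.
rewrite E => /(_ (Ck_on_derivable uC1 Us)).
by under [X in is_derive _ _ X _]eq_fun do rewrite E.
Qed.

Lemma is_derive_slice_grad v w y t : (forall s : R, U (s *: v + y, t)) ->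
  is_derive (0 : R) (1 : R) (fun r : R => dot (grad (r *: v + y) t) w)
    (\sum_i v 0 i * \sum_j w 0 j * hess y t i j).
Proof.
have E (r : R) : r *: (v, 0 : R) + (y, t) = (r *: v + y, t).
  by rewrite scale_pairD mulr0 add0r.
move=> Us.
have Uyt : U (y, t) by have := Us 0; rewrite scale0r add0r.
have wC1 : Ck_on 1 ('D_(w, 0) (ust u)) U := Ck_on_derive _ uC2.
rewrite (_ : (fun r => _) =
    (fun r => 'D_(w, 0) (ust u) (r *: (v, 0 : R) + (y, t)))); last first.
  by apply/funext => r; rewrite E D_pair.
have := @is_derive_line _ _ ('D_(w, 0) (ust u)) (y, t) (v, 0) 0.
rewrite E scale0r add0r => /(_ (Ck_on_derivable wC1 Uyt)).
rewrite (pair_sum v) (pair_sum w) (derive2_dir_sum _ _ _ _ uC2)//.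
rewrite (_ : \sum_i \sum_j _ = \sum_i v 0 i * \sum_j w 0 j * hess y t i j)//.
apply: eq_bigr => i _; rewrite mulr_sumr; apply: eq_bigr => j _.
by rewrite mulrA /hess u_ijE.
Qed.

Lemma is_derive_time y t : U (y, t) -> is_derive t (1 : R) (u y) (u_t u y t).
Proof.
move=> Uyt.
have := @is_derive_line _ _ (ust u) (y, 0) (0, 1) t.
have E (r : R) : r *: (0 : 'rV[R]_n, 1 : R) + (y, 0) = (y, r).
  by rewrite scale_pairD mulr1 addr0 scaler0 add0r.
rewrite E => /(_ (Ck_on_derivable uC1 Uyt)).
under [X in is_derive _ _ X _]eq_fun do rewrite E.
move=> H; have [df _] := H.
exact: derivableP df.
Qed.

End Slices.

(** * First and second variations at a spatial maximum *)

Section TwoPoint.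
Context {R : realType}.

(** Subtracting the parabola leaves a maximum at 0; the one-sided test applied to it and to its
    reflection gives both inequalities. *)
Lemma derive_eq_quadratic_bound (g : R -> R) (l a b : R) :
  is_derive (0 : R) (1 : R) g l ->
  (forall s, g s <= g 0 + s * a + s ^+ 2 * b) -> l = a.
Proof.
move=> dg gle.
have dh (c : R) : is_derive (0 : R) (1 : R)
    (fun s => g (c * s) - (c * s * a + (c * s) ^+ 2 * b)) (c * (l - a)).
  have dc : is_derive (0 : R) (1 : R) (fun s : R => c * s) c.
    rewrite (_ : (fun r => _) = c \*: id); last exact/funext.
    by apply: is_derive_eq; rewrite [_%:A]mulr1.
  have dg' : is_derive (c * 0) (1 : R) g l by rewrite mulr0.
  have d1 := is_derive1_comp dg' dc.
  have d2 : is_derive (0 : R) (1 : R)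
     (a \*: (fun s : R => c * s) + b \*: ((fun s : R => c * s) ^+ 2)) (c * a).
    by apply: is_derive_eq; rewrite /GRing.scale /=; ring.
  have := is_deriveB d1 d2.
  rewrite (_ : _ - _ = c * (l - a)); last by ring.
  rewrite (_ : _ - _ = fun s => g (c * s) - (c * s * a + (c * s) ^+ 2 * b))//.
  by apply/funext => s /=; rewrite /GRing.add /=; congr (_ - (_ + _)); rewrite mulrC.
have lt10 : -1 < 0 :> R by lra.
have max0 (c s : R) : g (c * s) - (c * s * a + (c * s) ^+ 2 * b) <=
    g (c * 0) - (c * 0 * a + (c * 0) ^+ 2 * b).
  by have := gle (c * s); rewrite mulr0 expr0n !mul0r; lra.
have := derive_ge0_at_left_max lt10 (dh 1) (fun s _ => max0 1 s).
have := derive_ge0_at_left_max lt10 (dh (-1)) (fun s _ => max0 (-1) s).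
by rewrite mulN1r mul1r => h1 h2; apply/eqP; rewrite eq_le; lra.
Qed.

Lemma is_derive_expR_comp (g : R -> R) (s l : R) : is_derive s (1 : R) g l ->
  is_derive s (1 : R) (fun r => expR (g r)) (expR (g s) * l).
Proof. by move=> dg; exact: (is_derive1_comp (is_derive_expR (g s)) dg). Qed.

Lemma is_deriveMl (g : R -> R) (c s l : R) : is_derive s (1 : R) g l ->
  is_derive s (1 : R) (fun r => c * g r) (c * l).
Proof. by move=> dg; exact: (is_deriveZ c dg). Qed.

Lemma is_derive_half_diff (g h : R -> R) (s l k : R) :
  is_derive s (1 : R) g l -> is_derive s (1 : R) h k ->
  is_derive s (1 : R) (fun r => (g r - h r) / 2) ((l - k) / 2).
Proof.
move=> dg dh; have := is_deriveMl 2^-1 (is_deriveB dg dh).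
rewrite mulrC; congr (is_derive _ _ _ _); apply/funext => r.
by rewrite mulrC.
Qed.

Lemma is_derive_exp_profile (b K : R) (d : R -> R) (s l : R) :
  is_derive s (1 : R) d l ->
  is_derive s (1 : R) (fun r => b * (expR (K * d r) - 1)) (b * expR (K * d s) * (K * l)).
Proof.
move=> dd.
have H := is_derive_expR_comp (is_deriveMl K dd).
have := is_deriveMl b (is_deriveB H (is_derive_cst (1 : R) (s : R) (1 : R))).
by rewrite subr0 mulrA.
Qed.

Context {n : nat} (u : 'rV[R]_n -> R -> R) (U : set ('rV[R]_n * R)).
Hypothesis uC2 : Ck_on 2 (ust u) U.
Implicit Types x y v : 'rV[R]_n.

(** For b = e^(-B/t) and K = k/t the slope and second derivative of the barrier are KE and K^2 E.
    The gradient formula comes from moving [y0] alone. Moving the points apart along [w], the half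
    difference has slope r/(KE), and the distance is affine, so the second-order condition involves
    the barrier only. *)
Lemma two_point_max_space (t K b : R) x0 y0 :
  (forall y, U (y, t)) -> 0 < K -> 0 < b -> y0 != x0 ->
  (forall x y, b * (expR (K * ((u y t - u x t) / 2)) - 1) -
       Num.sqrt (nsq (y - x)) / 2 <=
     b * (expR (K * ((u y0 t - u x0 t) / 2)) - 1) -
       Num.sqrt (nsq (y0 - x0)) / 2) ->
  let w := y0 - x0 in let r := Num.sqrt (nsq w) in
  let E := b * expR (K * ((u y0 t - u x0 t) / 2)) in
  let D := fun i j => hess u y0 t i j - hess u x0 t i j in
  [/\ grad u y0 t = grad u x0 t, grad u y0 t = (r * (K * E))^-1 *: w,
      (forall v : 'I_n -> R, qform D v <= 0) &
      qform D (fun i => w 0 i) <= - (2 * r ^+ 2 / (K * E ^+ 2))].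
Proof.
move=> Ut K0 b0 xy0 Wmax w r E D.
have E0 : 0 < E by rewrite mulr_gt0// expR_gt0.
have w0 : w != 0 by rewrite subr_eq0.
have r0 : 0 < r by rewrite sqrtr_gt0 nsq_gt0.
have r2 : r ^+ 2 = nsq w by rewrite sqr_sqrtr// nsq_ge0.
have KE0 : 0 < K * E by rewrite mulr_gt0.
have dslice v z (s : R) := @is_derive_slice _ _ _ _ uC2 v z t s (Ut _).
have dgrad v v' z := @is_derive_slice_grad _ _ _ _ uC2 v v' z t (fun s => Ut _).
(* Moving both points in parallel leaves the distance unchanged. *)
have par v : dot (grad u y0 t) v = dot (grad u x0 t) v /\
    qform D (fun i => v 0 i) <= 0.
  have := @MVT_le0_deriv2 R (fun s => u (s *: v + y0) t - u (s *: v + x0) t)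
    (fun s => dot (grad u (s *: v + y0) t) v - dot (grad u (s *: v + x0) t) v)
    (qform D (fun i => v 0 i)).
  case.
  - by near=> s; exact: (is_deriveB (dslice v y0 s) (dslice v x0 s)).
  - have := is_deriveB (dgrad v v y0) (dgrad v v x0).
    rewrite (_ : _ - _ = qform D (fun i => v 0 i)); first exact.
    rewrite /qform -sumrB; apply: eq_bigr => i _; rewrite -mulrBr -sumrB.
    by congr (_ * _); apply: eq_bigr => j _; rewrite mulrBr.
  - near=> s; rewrite !scale0r !add0r.
    have := Wmax (s *: v + x0) (s *: v + y0).
    rewrite opprD addrACA subrr add0r lerD2r ler_pM2l// lerD2r ler_expR ler_pM2l//.
    by rewrite ler_pM2r.
  by rewrite !scale0r !add0r => /eqP; rewrite subr_eq0 => /eqP.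
have gradE : grad u y0 t = grad u x0 t.
  apply/eqP; rewrite -subr_eq0 -nsq_eq0; apply/eqP.
  have [+ _] := par (grad u y0 t - grad u x0 t).
  by move=> H; rewrite /nsq {1}dotDl H -dotDl subrr -[0 in LHS](scale0r w) dotZl mul0r.
have gradw : grad u y0 t = (r * (K * E))^-1 *: w.
  have H v : E * (K * (dot (grad u y0 t) v / 2)) = dot v w / (2 * r).
    pose g s := b * (expR (K * ((u (s *: v + y0) t - u x0 t) / 2)) - 1).
    apply: (@derive_eq_quadratic_bound g _ _ (nsq v / (4 * r))).
      have := is_derive_exp_profile b K (is_derive_half_diff (dslice v y0 0)
        (is_derive_cst (u x0 t) (0 : R) (1 : R))).
      by rewrite subr0 scale0r add0r.
    move=> s; have := Wmax x0 (s *: v + y0).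
    rewrite -/w -/r /g scale0r add0r -addrA -/w nsqD nsqZ dotZl -r2.
    set N := Num.sqrt _.
    have N2 : N ^+ 2 = s ^+ 2 * nsq v + 2 * (s * dot v w) + r ^+ 2.
      by rewrite sqr_sqrtr// r2 -dotZl -nsqZ -nsqD nsq_ge0.
    (* This quadratic upper bound of the distance is an equality at s = 0, so the square root need
       not be differentiated. *)
    have : N <= (N ^+ 2 + r ^+ 2) / (2 * r).
      rewrite ler_pdivlMr ?mulr_gt0//.
      by have := sqr_ge0 (N - r); rewrite sqrrB; lra.
    rewrite N2 => NN W1.
    have E1 : s * (dot v w / (2 * r)) + s ^+ 2 * (nsq v / (4 * r)) =
       ((s ^+ 2 * nsq v + 2 * (s * dot v w) + r ^+ 2 + r ^+ 2) / (2 * r) - r) / 2.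
      by field; rewrite lt0r_neq0.
    lra.
  apply/eqP; rewrite -subr_eq0 -nsq_eq0; apply/eqP.
  set q := _ - _.
  have H' v : dot q v = 0.
    rewrite /q -scaleNr dotDl dotZl (dotC w).
    move: (H v) => Hv.
    have -> : dot (grad u y0 t) v = 2 / (K * E) * (E * (K * (dot (grad u y0 t) v / 2))).
      by field; rewrite !lt0r_neq0.
    by rewrite Hv; field; rewrite !lt0r_neq0.
  exact: H'.
split=> //.
- move=> v; have [_] := par (\row_i v i).
  rewrite (_ : qform D (fun i => _) = qform D v)//.
  apply: eq_bigr => i _; rewrite mxE; congr (_ * _).
  by apply: eq_bigr => j _; rewrite mxE.
(* Moving the points by s w and -s w scales their difference by 1 + 2s, so half the distance is r s
   + r/2 for small s. *)
pose d (s : R) := (u (s *: w + y0) t - u (s *: (- w) + x0) t) / 2.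
pose d1 (s : R) := (dot (grad u (s *: w + y0) t) w -
                    dot (grad u (s *: (- w) + x0) t) (- w)) / 2.
have dd s : is_derive s (1 : R) d (d1 s).
  exact: is_derive_half_diff (dslice w y0 s) (dslice (- w) x0 s).
have dd1 : is_derive (0 : R) (1 : R) d1 (qform D (fun i => w 0 i) / 2).
  have := is_derive_half_diff (dgrad w w y0) (dgrad (- w) (- w) x0).
  rewrite (_ : _ - _ = qform D (fun i => w 0 i))//.
  rewrite /qform -sumrB; apply: eq_bigr => i _.
  rewrite [(- w) 0 i]mxE mulNr -mulrN -mulrBr -sumrN -sumrB.
  congr (_ * _); apply: eq_bigr => j _.
  by rewrite [(- w) 0 j]mxE /D mulNr opprK mulrBr.
have [|||] := @MVT_le0_deriv2 R (fun s => b * (expR (K * d s) - 1) - (r * s + r / 2))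
  (fun s => b * expR (K * d s) * (K * d1 s) - r)
  (b * expR (K * d 0) * (K * (qform D (fun i => w 0 i) / 2)) +
    K * d1 0 * (b * (expR (K * d 0) * (K * d1 0)))).
- near=> s.
  have := is_deriveB (is_derive_exp_profile b K (dd s))
    (is_deriveD (is_deriveMl r (is_derive_id s (1 : R))) (is_derive_cst (r / 2) (s : R) (1 : R))).
  by rewrite mulr1 addr0.
- have := is_deriveB (is_deriveM (is_deriveMl b (is_derive_expR_comp (is_deriveMl K (dd 0))))
    (is_deriveMl K dd1)) (is_derive_cst r (0 : R) (1 : R)).
  by rewrite subr0.
- near=> s; have s12 : 0 < 1 + 2 * s.
    have : `|s| < 1 / 2.
      near: s; apply/nbhs_ballP; exists (1 / 2) => /=; first lra.
      by move=> s; rewrite /ball /= sub0r normrN.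
    by rewrite ltr_norml; lra.
  have := Wmax (s *: (- w) + x0) (s *: w + y0).
  rewrite (_ : s *: w + y0 - _ = (1 + 2 * s) *: w); last first.
    by rewrite /w; apply/rowP => i; rewrite !mxE; ring.
  rewrite nsqZ sqrtrM ?sqr_ge0// sqrtr_sqr gtr0_norm// -/w -/r /d.
  by rewrite !scale0r !add0r; lra.
have d0 : d 0 = (u y0 t - u x0 t) / 2 by rewrite /d !scale0r !add0r.
have d10 : d1 0 = r / (K * E).
  rewrite /d1 !scale0r !add0r -gradE gradw -[- w]scaleN1r dotZr !dotZl -/(nsq w) -r2.
  by field; rewrite !lt0r_neq0.
move=> _; rewrite d0 -/E d10.
rewrite (_ : _ + _ = K * E / 2 *
   (qform D (fun i => w 0 i) + 2 * r ^+ 2 / (K * E ^+ 2))); last first.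
  by rewrite [b * (expR _ * _)]mulrA -/E; field; rewrite !lt0r_neq0.
by rewrite pmulr_rle0 ?divr_gt0// -lerBrDr sub0r.
Unshelve. all: by end_near.
Qed.

End TwoPoint.

(** * The barrier: behaviour in time and subsolution property *)

Section Barrier.
Context {R : realType}.
Implicit Types B k t z : R.

Definition barrier B k t z : R := expR (- (B / t)) * (expR (k / t * z) - 1).

(** The right-hand side is the time derivative of the barrier along [d]: the barrier equals E - b at
    t0, and its factor e^(-B/t) has logarithmic derivative B/t^2. *)
Lemma barrier_max_time B k t1 t0 (d : R -> R) (d' b E : R) :
  b = expR (- (B / t0)) -> E = b * expR (k / t0 * d t0) ->
  0 < t0 -> t1 < t0 -> is_derive t0 (1 : R) d d' ->
  (forall s, t1 <= s <= t0 -> barrier B k s (d s) <= barrier B k t0 (d t0)) ->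
  0 <= B / t0 ^+ 2 * (E - b) + E * (k / t0 * d' - k / t0 ^+ 2 * d t0).
Proof.
move=> bE EE t00 t10 dd dmax.
have tn0 : t0 != 0 := lt0r_neq0 t00.
have dinv c : is_derive t0 (1 : R) (fun s => c / s) (- (c / t0 ^+ 2)).
  have := is_deriveMl c (@is_deriveV _ id t0 1 1 tn0 (is_derive_id t0 (1 : R))).
  by rewrite [_%:A]mulr1 mulrN.
have dB : is_derive t0 (1 : R) (fun s => expR (- (B / s))) (b * (B / t0 ^+ 2)).
  have := is_derive_expR_comp (is_deriveN (dinv B)).
  by rewrite opprK -bE.
have dK : is_derive t0 (1 : R) (fun s => expR (k / s * d s))
    (expR (k / t0 * d t0) * (k / t0 * d' + d t0 * - (k / t0 ^+ 2))).
  exact: is_derive_expR_comp (is_deriveM (dinv k) dd).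
have dW : is_derive t0 (1 : R) (fun s => barrier B k s (d s))
    (b * (expR (k / t0 * d t0) * (k / t0 * d' + d t0 * - (k / t0 ^+ 2)) - 0) +
     (expR (k / t0 * d t0) - 1) * (b * (B / t0 ^+ 2))).
  rewrite {1}bE; exact: is_deriveM dB (is_deriveB dK (is_derive_cst (1 : R) t0 (1 : R))).
apply: le_trans (derive_ge0_at_left_max t10 dW dmax) _.
rewrite le_eqVlt; apply/orP; left; apply/eqP.
rewrite EE subr0; ring.
Qed.

Lemma barrier_gt0 B k t z : 0 < k -> 0 < t -> 0 < barrier B k t z -> 0 < z.
Proof.
move=> k0 t0; rewrite pmulr_rgt0 ?expR_gt0// subr_gt0 -expR0 ltr_expR.
by rewrite pmulr_rgt0// divr_gt0.
Qed.

Lemma barrier_lt B k t z M : 0 < k -> 0 < t -> z <= M ->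
  barrier B k t z < expR ((k * M - B) / t).
Proof.
move=> k0 t0 zM; rewrite /barrier mulrBr mulr1 -expRD ltrBlDr.
rewrite (@le_lt_trans _ _ (expR ((k * M - B) / t)))//; last by rewrite ltrDl expR_gt0.
rewrite ler_expR addrC mulrBl lerD2r mulrAC ler_pM2r ?invr_gt0//.
by rewrite ler_pM2l.
Qed.

Lemma barrier_ge_linear B k t z : expR (- (B / t)) * (k / t * z) <= barrier B k t z.
Proof.
by rewrite ler_wpM2l ?expR_ge0// lerBrDr addrC expR_ge1Dx.
Qed.

Lemma sqr_le_expR (x : R) : 0 <= x -> x ^+ 2 / 4 <= expR x.
Proof.
move=> x0; have -> : expR x = expR (x / 2) ^+ 2.
  by rewrite -expRM_natl; congr expR; field.
apply: le_trans (_ : (1 + x / 2) ^+ 2 <= _); first by rewrite sqrrD; nra.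
by rewrite ler_sqr ?nnegrE ?expR_ge0 ?expR_ge1Dx// addr_ge0// divr_ge0.
Qed.

(* A barrier of slope at most 1 is a strict subsolution of
   [rho_t = c * rho'' / (1 + rho'^2)] as soon as [2 B <= c k^2]. *)
Lemma barrier_subsolution (c B k t d d' E : R) :
  0 < c -> 0 < B -> 0 < k -> 0 < t -> 0 <= d -> 0 < E -> k / t * E <= 1 ->
  2 * B <= c * k ^+ 2 ->
  d' <= - (c / (1 + ((k / t * E) ^+ 2)^-1) / (k / t * E ^+ 2)) ->
  E * (k / t * d' - k / t ^+ 2 * d) + B / t ^+ 2 * E <= 0.
Proof.
move=> c0 B0 k0 t0 d0 E0 KE1 Bk d'le.
pose K := k / t; have K0 : 0 < K by rewrite divr_gt0.
rewrite -/K in KE1 d'le *.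
have KE0 : 0 < K * E by rewrite mulr_gt0.
have t20 : 0 < t ^+ 2 by rewrite exprn_gt0.
have kd : 0 <= k / t ^+ 2 * d by rewrite mulr_ge0// divr_ge0 ?ltW.
have H : K * d' <= - (c * K ^+ 2 / 2).
  apply: le_trans (ler_wpM2l (ltW K0) d'le) _.
  rewrite mulrN lerN2.
  have -> : K * (c / (1 + ((K * E) ^+ 2)^-1) / (K * E ^+ 2)) =
      c * K ^+ 2 / (1 + (K * E) ^+ 2).
    by field; rewrite !lt0r_neq0// addr_gt0// exprn_gt0.
  (* Slope at most 1 bounds 1 + rho'^2 by 2, which costs the factor 1/2 in c K^2 / 2. *)
  have Z1 : (K * E) ^+ 2 <= 1 by rewrite expr_le1// ltW.
  have Z0 : 0 < (K * E) ^+ 2 by rewrite exprn_gt0.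
  have V : 2^-1 <= (1 + (K * E) ^+ 2)^-1.
    by rewrite lef_pV2 ?posrE ?addr_gt0//; lra.
  by apply: ler_wpM2l V; rewrite mulr_ge0 ?exprn_ge0// ltW.
have B2 : B / t ^+ 2 <= c * K ^+ 2 / 2.
  rewrite ler_pdivrMr// /K exprMn exprVn.
  rewrite (_ : _ / 2 * _ = c * k ^+ 2 / 2); last by field; rewrite lt0r_neq0.
  lra.
nra.
Qed.

End Barrier.

Section TraceBound.
Context {R : realType} {n : nat}.

(** By Cauchy-Schwarz the form of [a] dominates al (v.w)^2/|w|^2. Removing this rank-one part leaves
    a semidefinite matrix whose trace against [D] is nonpositive, and the removed part is the
    right-hand side. *)
Lemma trace_le_coercive (a D : 'I_n -> 'I_n -> R) (al : R) (w : 'rV[R]_n) :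
  (forall i j, a i j = a j i) -> 0 <= al ->
  (forall v : 'rV[R]_n, al * nsq v <= qform a (fun i => v 0 i)) ->
  (forall v, qform D v <= 0) -> w != 0 ->
  \sum_i \sum_j a i j * D i j <= al / nsq w * qform D (fun i => w 0 i).
Proof.
move=> asym al0 acoer Dneg w0.
have N0 : 0 < nsq w by rewrite nsq_gt0.
pose q := al / nsq w; have q0 : 0 <= q by rewrite divr_ge0// ltW.
pose B i j := a i j - q * (w 0 i * w 0 j).
have : \sum_i \sum_j B i j * D i j <= 0.
  apply: psd_nsd_trace_le0 => //.
    by move=> i j; rewrite /B asym [w 0 i * _]mulrC.
  move=> v; pose v' := \row_i v i.
  have -> : qform B v = qform a (fun i => v' 0 i) - q * dot v' w ^+ 2.
    rewrite expr2 {1}/dot mulr_suml mulr_sumr -sumrB; apply: eq_bigr => i _.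
    rewrite mxE -mulrA mulrCA -mulrBr; congr (_ * _).
    rewrite mulrA /dot mulr_sumr -sumrB; apply: eq_bigr => j _.
    by rewrite !mxE /B; ring.
  rewrite subr_ge0 (le_trans _ (acoer _))//.
  rewrite /q -mulrA ler_wpM2l// mulrC ler_pdivrMr//.
  exact: dot_sq_le.
have -> : \sum_i \sum_j B i j * D i j =
    \sum_i \sum_j a i j * D i j - q * qform D (fun i => w 0 i).
  rewrite mulr_sumr -sumrB; apply: eq_bigr => i _.
  rewrite !mulr_sumr -sumrB; apply: eq_bigr => j _.
  by rewrite /B; ring.
by rewrite subr_le0.
Qed.

End TraceBound.

(** * Gradient estimate for bounded periodic solutions *)

Section BarrierEstimate.
Context {R : realType} {n : nat}.

(** Removing the integer parts of the coordinates in the row basis leaves coefficients in [0, 1). *)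
Lemma lattice_reduce (L : 'M[R]_n) : L \in unitmx ->
  exists2 r : R, 0 <= r & forall x : 'rV[R]_n, exists k : 'I_n -> int,
    `|x + \sum_(i < n) (k i)%:~R *: row i L| <= r.
Proof.
move=> Lu; exists (\sum_(i < n) `|row i L|); first by apply: sumr_ge0.
move=> x; pose c := x *m invmx L.
exists (fun i => - Num.floor (c 0 i)).
have {1}-> : x = c *m L by rewrite /c mulmxKV.
rewrite mulmx_sum_row -big_split /= (le_trans (ler_norm_sum _ _ _))//.
apply: ler_sum => i _; rewrite -scalerDl normrZ ler_piMl//.
rewrite mulrNz ger0_norm ?subr_ge0 ?floor_le// lerBlDr.
by rewrite addrC -[1]/(1%:~R) -intrD ltW// floorD1_gt.
Qed.

Lemma compact_norm_le (r : R) : compact [set x : 'rV[R]_n | `|x| <= r].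
Proof.
apply: bounded_closed_compact.
  exists r; split; first exact: num_real.
  by move=> s rs x /= xr; rewrite (le_trans xr)// ltW.
have /continuous_closedP cl := @norm_continuous R 'rV[R]_n.
exact: (cl _ (@closed_le _ r)).
Qed.

Context (u : 'rV[R]_n -> R -> R) (U : set ('rV[R]_n * R)) (T M c : R)
  (a : 'rV[R]_n -> 'I_n -> 'I_n -> R) (L : 'M[R]_n).
Hypothesis uC2 : Ck_on 2 (ust u) U.
Hypothesis UT : forall y t, 0 <= t <= T -> U (y, t).
Hypothesis asym : forall p i j, a p i j = a p j i.
Hypothesis acoercive : forall p v : 'rV[R]_n,
  c * nsq v <= qform (a p) (fun i => v 0 i) * (1 + nsq p).
Hypothesis ueq : forall y t, 0 <= t <= T ->
  u_t u y t = \sum_i \sum_j a (grad u y t) i j * hess u y t i j.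
Hypothesis uM : forall y t, 0 <= t <= T -> `|u y t| <= M.
Hypothesis uper : lattice_periodic L u T.
Hypotheses (c0 : 0 < c) (M0 : 0 < M).

Let k := 4 * M / c.
Let B := 2 * (k * M).

Let k0 : 0 < k. Proof. by rewrite divr_gt0// mulr_gt0. Qed.
Let B0 : 0 < B. Proof. by apply: mulr_gt0 => //; apply: mulr_gt0. Qed.

Definition two_point (x y : 'rV[R]_n) (t : R) : R :=
  barrier B k t ((u y t - u x t) / 2) - Num.sqrt (nsq (y - x)) / 2.

Let half_diff_le x y t : 0 <= t <= T -> (u y t - u x t) / 2 <= M.
Proof.
move=> tT; have := uM x tT; have := uM y tT; rewrite !ler_norml; lra.
Qed.

Let two_point_lt x y t : 0 < t <= T ->
  two_point x y t + Num.sqrt (nsq (y - x)) / 2 < expR (- (k * M / t)).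
Proof.
move=> /andP[t0 tT]; rewrite /two_point subrK.
have := @barrier_lt _ B k t _ _ k0 t0 (half_diff_le x y (introT andP (conj (ltW t0) tT))).
by rewrite (_ : (k * M - B) / t = - (k * M / t))// /B; ring.
Qed.

(** With X = kM/t, the bound X^2/4 <= e^X gives k/t <= e^X exactly when t <= kM^2/4 is used. *)
Let slope_le1 t E : 0 < t -> t <= k * M ^+ 2 / 4 -> E <= expR (- (k * M / t)) ->
  k / t * E <= 1.
Proof.
move=> t0 tM EM.
have kM : 0 <= k * M / t.
  by apply: divr_ge0; [apply: mulr_ge0|]; exact: ltW.
have kt : 0 < k / t by rewrite divr_gt0.
apply: le_trans (ler_wpM2l (ltW kt) EM) _.
rewrite expRN ler_pdivrMr ?expR_gt0// mul1r (le_trans _ (sqr_le_expR kM))//.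
rewrite (_ : _ / 4 = k / t * (k * M ^+ 2 / 4 / t)); last by field; rewrite lt0r_neq0.
by rewrite ler_peMr ?(ltW kt)// ler_pdivlMr// mul1r.
Qed.

Let two_point_continuous (z : 'rV[R]_n * 'rV[R]_n * R) : 0 < z.2 <= T ->
  {for z, continuous (fun z => two_point z.1.1 z.1.2 z.2)}.
Proof.
move=> /andP[z0 zT].
have zU y : U (y, z.2) by apply: UT; rewrite (ltW z0).
have c2 : (fun z : 'rV[R]_n * 'rV[R]_n * R => z.2) z @[z --> z] --> z.2 by exact: cvg_snd.
have c1 : (fun z : 'rV[R]_n * 'rV[R]_n * R => z.1) z @[z --> z] --> z.1 by exact: cvg_fst.
have c11 : (fun z : 'rV[R]_n * 'rV[R]_n * R => z.1.1) z @[z --> z] --> z.1.1.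
  apply: (@cvg_comp _ _ _ (fun z : 'rV[R]_n * 'rV[R]_n * R => z.1) fst _ (nbhs z.1)) => //.
  exact: cvg_fst.
have c12 : (fun z : 'rV[R]_n * 'rV[R]_n * R => z.1.2) z @[z --> z] --> z.1.2.
  apply: (@cvg_comp _ _ _ (fun z : 'rV[R]_n * 'rV[R]_n * R => z.1) snd _ (nbhs z.1)) => //.
  exact: cvg_snd.
have cu (f : 'rV[R]_n * 'rV[R]_n -> 'rV[R]_n) :
    (fun z : 'rV[R]_n * 'rV[R]_n * R => f z.1) z @[z --> z] --> f z.1 ->
    (fun z : 'rV[R]_n * 'rV[R]_n * R => u (f z.1) z.2) z @[z --> z] --> u (f z.1) z.2.
  move=> cf; have cU := Ck_on_continuous uC2 (zU (f z.1)).
  exact: (cvg_comp2 (h := u) cf c2 cU).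
have cK (q : R) : (fun z : 'rV[R]_n * 'rV[R]_n * R => q / z.2) z @[z --> z] --> q / z.2.
  by apply: cvgM; [exact: cvg_cst|apply: cvgV => //; exact: lt0r_neq0].
have cexp (f : 'rV[R]_n * 'rV[R]_n * R -> R) : f z @[z --> z] --> f z ->
    expR (f z) @[z --> z] --> expR (f z).
  move=> cf; apply: (@cvg_comp _ _ _ f expR _ (nbhs (f z))) => //.
  exact: continuous_expR.
apply: cvgB.
  apply: cvgM; first by apply: (cexp (fun z => - (B / z.2))); exact: cvgN.
  apply: cvgB; last exact: cvg_cst.
  apply: (cexp (fun z => k / z.2 * ((u z.1.2 z.2 - u z.1.1 z.2) / 2))).
  apply: cvgM => //; apply: cvgM; last exact: cvg_cst.
  by apply: cvgB; [exact: (cu snd)|exact: (cu fst)].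
apply: cvgM; last exact: cvg_cst.
apply: (@cvg_comp _ _ _ (fun z : 'rV[R]_n * 'rV[R]_n * R => nsq (z.1.2 - z.1.1)) Num.sqrt
  _ (nbhs (nsq (z.1.2 - z.1.1)))); last exact: sqrt_continuous.
apply: (@cvg_comp _ _ _ (fun z : 'rV[R]_n * 'rV[R]_n * R => z.1.2 - z.1.1) nsq
  _ (nbhs (z.1.2 - z.1.1))); last exact: nsq_continuous.
exact: cvgB.
Qed.


(** The spatial conditions and the equation bound the time derivative of the half difference from
    above, which the time condition contradicts. The points differ because the barrier vanishes at
    0. *)
Let two_point_max_absurd x0 y0 t1 t0 :
  0 < t1 < t0 -> t0 <= T -> t0 <= k * M ^+ 2 / 4 -> 0 < two_point x0 y0 t0 ->
  ~ (forall x y t, t1 <= t <= t0 -> two_point x y t <= two_point x0 y0 t0).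
Proof.
move=> /andP[t10 t1t0] t0T t0M W0 Wmax.
have t00 : 0 < t0 := lt_trans t10 t1t0.
have t0I : 0 <= t0 <= T by rewrite (ltW t00).
have xy0 : y0 != x0.
  apply/eqP => xyE; move: W0; rewrite /two_point xyE subrr mul0r /barrier mulr0.
  by rewrite expR0 subrr mulr0 sub0r oppr_gt0 ltNge divr_ge0 ?sqrtr_ge0.
pose d s := (u y0 s - u x0 s) / 2.
have d0 : 0 < d t0.
  apply: (@barrier_gt0 _ B k t0) => //; rewrite (lt_le_trans W0)// /two_point.
  by rewrite gerBl divr_ge0 ?sqrtr_ge0.
have dM : d t0 <= M by exact: half_diff_le.
pose K := k / t0; pose b := expR (- (B / t0)); pose E := b * expR (K * d t0).
have K0 : 0 < K by rewrite divr_gt0.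
have b0 : 0 < b by rewrite expR_gt0.
have E0 : 0 < E by rewrite mulr_gt0// expR_gt0.
have KE1 : K * E <= 1.
  apply: slope_le1 => //; rewrite /E /b -expRD ler_expR.
  have : K * d t0 <= K * M by rewrite ler_pM2l.
  have -> : K * M = k * M / t0 by rewrite /K mulrAC.
  have -> : B / t0 = 2 * (k * M / t0) by rewrite [RHS]mulrA.
  lra.
have Ut y : U (y, t0) by exact: UT.
have t0t : t1 <= t0 <= t0 by rewrite lexx (ltW t1t0).
have [gE gw Dneg Dw] := two_point_max_space uC2 Ut K0 b0 xy0
  (fun x y => Wmax x y t0 t0t).
rewrite -/(d t0) -/E in gw Dw.
set w := y0 - x0 in gw Dw.
have w0 : w != 0 by rewrite subr_eq0.
have N0 : 0 < nsq w by rewrite nsq_gt0.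
have r2 : Num.sqrt (nsq w) ^+ 2 = nsq w by rewrite sqr_sqrtr// ltW.
have KE0 : 0 < K * E by rewrite mulr_gt0.
set p := grad u y0 t0 in gE gw.
have pE : nsq p = ((K * E) ^+ 2)^-1.
  rewrite gw nsqZ exprVn exprMn r2 invfM mulrAC mulVf ?mul1r//.
  exact: lt0r_neq0.
have p1 : 0 < 1 + nsq p by rewrite ltr_pwDl// nsq_ge0.
pose al := c / (1 + nsq p); have al0 : 0 < al by rewrite divr_gt0.
pose d' := (u_t u y0 t0 - u_t u x0 t0) / 2.
have d'le : d' <= - (al / (K * E ^+ 2)).
  have acoer v : al * nsq v <= qform (a p) (fun i => v 0 i).
    by rewrite /al mulrAC ler_pdivrMr.
  have := trace_le_coercive (asym p) (ltW al0) acoer Dneg w0.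
  have -> : \sum_i \sum_j a p i j * (hess u y0 t0 i j - hess u x0 t0 i j) = 2 * d'.
    rewrite /d' mulrCA divff// mulr1 !ueq// -gE -/p -sumrB; apply: eq_bigr => i _.
    by rewrite -sumrB; apply: eq_bigr => j _; rewrite mulrBr.
  have alN : 0 <= al / nsq w by rewrite divr_ge0 ?ltW.
  have := ler_wpM2l alN Dw; rewrite r2.
  have -> : al / nsq w * - (2 * nsq w / (K * E ^+ 2)) = 2 * - (al / (K * E ^+ 2)).
    by field; rewrite !lt0r_neq0.
  move=> h1 h2; have := le_trans h2 h1.
  by rewrite ler_pM2l.
have dd : is_derive t0 (1 : R) d d'.
  exact: is_derive_half_diff (is_derive_time uC2 (Ut y0)) (is_derive_time uC2 (Ut x0)).
have dmax s : t1 <= s <= t0 -> barrier B k s (d s) <= barrier B k t0 (d t0).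
  by move=> /(Wmax x0 y0); rewrite /two_point lerD2r.
have := barrier_max_time (erefl b) (erefl E) t00 t1t0 dd dmax.
have Bc : 2 * B <= c * k ^+ 2.
  rewrite le_eqVlt; apply/orP; left; apply/eqP; rewrite /B /k.
  by field; exact: lt0r_neq0.
rewrite /al pE in d'le.
have := barrier_subsolution c0 B0 k0 t00 (ltW d0) E0 KE1 Bc d'le.
(* The two inequalities differ by exactly this positive term, which comes from the -1 in the
   barrier. *)
have Bb : 0 < B / t0 ^+ 2 * b by rewrite mulr_gt0// divr_gt0// exprn_gt0.
rewrite mulrBr; lra.
Qed.

Lemma two_point_le0 x y t : 0 < t <= T -> t <= k * M ^+ 2 / 4 ->
  two_point x y t <= 0.
Proof.
move=> /andP[t0 tT] tM; rewrite leNgt; apply/negP => Wpos.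
pose m := two_point x y t.
have kM0 : 0 < k * M by exact: mulr_gt0.
(* At [t1] all values lie below [m], since e^(-kM/t1) <= t1/(kM) <= m; hence the maximum over later
   times is not attained at the initial slice. *)
pose t1 := Num.min (t / 2) (k * M * m).
have t10 : 0 < t1 by rewrite lt_min divr_gt0//= mulr_gt0.
have t1t : t1 < t.
  by rewrite (@le_lt_trans _ _ (t / 2))// ?ge_min ?lexx// gtr_pMr// invf_lt1// ltr1n.
have early x' y' : two_point x' y' t1 < m.
  have t1T : 0 < t1 <= T by rewrite t10 (le_trans (ltW t1t)).
  have sq0 : 0 <= Num.sqrt (nsq (y' - x')) / 2 by rewrite divr_ge0 ?sqrtr_ge0.
  apply: le_lt_trans (_ : two_point x' y' t1 + Num.sqrt (nsq (y' - x')) / 2 < _).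
    by rewrite lerDl.
  apply: lt_le_trans (two_point_lt x' y' t1T) _.
  rewrite expRN -[leRHS]invrK lef_pV2 ?posrE ?expR_gt0 ?invr_gt0//.
  apply: le_trans (expR_ge1Dx _); apply: le_trans (_ : k * M / t1 <= _); last by rewrite lerDr.
  by rewrite ler_pdivlMr// mulrC ler_pdivrMr// ge_min lexx orbT.
have [Lu per] := uper.
have [r r0 rP] := lattice_reduce Lu.
(* The barrier is below 1, so a positive value of [two_point] forces |y - x| <= 2; this is the
   margin added to [r]. *)
pose S : set ('rV[R]_n * 'rV[R]_n * R) :=
  ([set z | `|z| <= r] `*` [set z | `|z| <= r + 2]) `*` `[t1, t].
(* Both points can be translated by the same lattice vector. *)
have reach x' y' s : t1 <= s <= t -> 0 < two_point x' y' s ->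
    exists2 z, S (z, s) & two_point z.1 z.2 s = two_point x' y' s.
  move=> sI Ws; have /andP[t1s st] := sI.
  have s0 : 0 < s := lt_le_trans t10 t1s.
  have sT : s <= T := le_trans st tT.
  have [l lP] := rP x'; set v := \sum_(i < n) _ in lP.
  have uv z : u (z + v) s = u z s by apply: per; rewrite (ltW s0).
  exists (x' + v, y' + v); last first.
    by rewrite /two_point /= !uv opprD addrACA subrr addr0.
  split => /=; last by rewrite in_itv.
  split => //=.
  rewrite (_ : y' + v = (x' + v) + (y' - x')); last first.
    by rewrite [x' + v]addrC -addrA [x' + _]addrC subrK addrC.
  rewrite (le_trans (ler_normD _ _))// lerD//.
  have sq2 : Num.sqrt (nsq (y' - x')) <= 2.
    have sTI : 0 < s <= T by rewrite s0.
    have := two_point_lt x' y' sTI.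
    have : expR (- (k * M / s)) <= 1.
      by rewrite expR_le1 oppr_le0 divr_ge0 ?ltW.
    lra.
  apply: rV_norm_le => // j; apply: le_trans sq2.
  rewrite -sqrtr_sqr ler_wsqrtr//; exact: coord_sq_le_nsq.
have tI : t1 <= t <= t by rewrite lexx (ltW t1t).
have [z zS zE] := reach x y t tI Wpos.
have [|||[[x0 y0] t0'] z0S z0max] := @compact_EVT_max _ R
  (fun z => two_point z.1.1 z.1.2 z.2) S.
- by exists (z, t).
- apply: compact_setX; last exact: segment_compact.
  by apply: compact_setX; exact: compact_norm_le.
- apply: continuous_in_subspaceT => q; rewrite inE => -[_] /=.
  rewrite in_itv /= => /andP[q1 q2]; apply: two_point_continuous.
  by rewrite (lt_le_trans t10)//= (le_trans q2).
have mz0 : m <= two_point x0 y0 t0'.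
  by rewrite /m -zE; apply: (z0max (z, t)); rewrite inE.
have gmax x' y' s : t1 <= s <= t -> two_point x' y' s <= two_point x0 y0 t0'.
  move=> sI; have [W0|W0] := leP (two_point x' y' s) 0.
    by rewrite (le_trans W0)// (le_trans _ mz0)// ltW.
  have [z' z'S <-] := reach x' y' s sI W0.
  by apply: (z0max (z', s)); rewrite inE.
move: z0S; rewrite inE => -[_] /=; rewrite in_itv /= => /andP[t1t0 t0t].
have t10t : t1 < t0'.
  rewrite lt_neqAle t1t0 andbT; apply/eqP => t1E.
  by move: (early x0 y0); rewrite t1E ltNge mz0.
apply: (@two_point_max_absurd x0 y0 t1 t0').
- by rewrite t10.
- exact: le_trans tT.
- exact: le_trans tM.
- exact: lt_le_trans mz0.
- by move=> x' y' s /andP[s1 s2]; apply: gmax; rewrite s1 (le_trans s2).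
Qed.

(** The barrier lies above its tangent at 0, so [two_point_le0] becomes a Lipschitz bound. *)
Lemma increment_le x y t : 0 < t <= T -> t <= k * M ^+ 2 / 4 ->
  u y t - u x t <= t / k * expR (B / t) * Num.sqrt (nsq (y - x)).
Proof.
move=> tI tM; have /andP[t0 _] := tI.
have := two_point_le0 x y tI tM; rewrite subr_le0 => /(le_trans (barrier_ge_linear _ _ _ _)).
rewrite expRN mulrC ler_pdivrMr ?expR_gt0// => H.
have kt : 0 < k / t by rewrite divr_gt0.
rewrite -(ler_pM2l kt) (_ : k / t * (t / k * _ * _) =
  2 * (Num.sqrt (nsq (y - x)) / 2 * expR (B / t))).
  rewrite [leLHS](_ : _ = 2 * (k / t * ((u y t - u x t) / 2))) ?ler_pM2l//.
  by field; exact: lt0r_neq0.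
by field; rewrite !lt0r_neq0.
Qed.

Lemma grad_le x t : 0 < t <= T -> t <= k * M ^+ 2 / 4 ->
  Num.sqrt (nsq (grad u x t)) <= t / k * expR (B / t).
Proof.
move=> tI tM; have /andP[t0 tT] := tI.
set p := grad u x t; set G := t / k * _.
have G0 : 0 <= G by rewrite mulr_ge0 ?expR_ge0// divr_ge0// ltW.
have [p0|p0] := eqVneq p 0.
  by have -> : nsq p = 0; [apply/eqP; rewrite nsq_eq0 p0|rewrite sqrtr0].
set N := Num.sqrt (nsq p).
have N0 : 0 < N by rewrite sqrtr_gt0 nsq_gt0.
have N2 : N ^+ 2 = nsq p by rewrite sqr_sqrtr// nsq_ge0.
have xtU s : U (s *: p + x, t) by apply: UT; rewrite (ltW t0).
(* By the Lipschitz bound along the gradient direction, this function on [-1, 0] is maximal at 0;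
   its slope there is -N^2 + GN. *)
have dh : is_derive (0 : R) (1 : R) (fun s => - u (s *: p + x) t + G * N * s)
    (- dot (grad u (0 *: p + x) t) p + G * N * 1).
  exact: (is_deriveD (is_deriveN (is_derive_slice uC2 (xtU 0)))
    (is_deriveMl (G * N) (is_derive_id (0 : R) (1 : R)))).
have m10 : -1 < 0 :> R by lra.
have := derive_ge0_at_left_max m10 dh.
rewrite mulr1 scale0r add0r -/p -/(nsq p) -N2 => H.
have : 0 <= - N ^+ 2 + G * N.
  apply: H => s /andP[_ s0].
  have := increment_le (s *: p + x) x tI tM.
  rewrite -/G (_ : x - (s *: p + x) = (- s) *: p); last first.
    by rewrite scaleNr opprD addrC subrK.
  rewrite nsqZ sqrtrM ?sqr_ge0// sqrtr_sqr ger0_norm ?oppr_ge0// -/N.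
  by rewrite ?scale0r ?add0r ?mulr0; lra.
by rewrite addrC subr_ge0 expr2 ler_pM2r.
Qed.

End BarrierEstimate.

(** * Normals of graphs and the final comparison *)

Section GraphNormal.
Context {R : realType} {n : nat}.
Implicit Types p v : 'rV[R]_n.

Definition horizontal v : 'rV[R]_n.+1 := \sum_(i < n) v 0 i *: phi R (lift ord0 i).

Definition graph_normal p : 'rV[R]_n.+1 := horizontal p - phi0 R n.

Lemma nu_of_grad (u : 'rV[R]_n -> R -> R) y t :
  nu_of u y t = graph_normal (grad u y t).
Proof.
by rewrite /nu_of /Du /graph_normal; congr (_ - _); apply: eq_bigr => i _; rewrite mxE.
Qed.

Let horizontal0 v : horizontal v 0 ord0 = 0.
Proof.
rewrite /horizontal summxE big1// => i _.
by rewrite !mxE (negbTE (neq_lift _ _)) mulr0.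
Qed.

Let horizontalS v i : horizontal v 0 (lift ord0 i) = v 0 i.
Proof.
rewrite /horizontal summxE (bigD1 i)//= !mxE !eqxx mulr1 big1 ?addr0// => j ji.
by rewrite !mxE (inj_eq lift_inj) eq_sym (negbTE ji) mulr0.
Qed.

Let graph_normal0 p : graph_normal p 0 ord0 = -1.
Proof. by rewrite mxE horizontal0 !mxE eqxx add0r. Qed.

Let graph_normalS p i : graph_normal p 0 (lift ord0 i) = p 0 i.
Proof.
by rewrite mxE horizontalS !mxE eq_sym (negbTE (neq_lift _ _)) oppr0 addr0.
Qed.

Lemma nsq_horizontal v : nsq (horizontal v) = nsq v.
Proof.
rewrite /nsq /dot big_ord_recl horizontal0 mul0r add0r.
by apply: eq_bigr => i _; rewrite horizontalS.
Qed.

Lemma nsq_graph_normal p : nsq (graph_normal p) = 1 + nsq p.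
Proof.
rewrite /nsq /dot big_ord_recl graph_normal0 mulrNN mul1r; congr (_ + _).
by apply: eq_bigr => i _; rewrite graph_normalS.
Qed.

Lemma dot_horizontal_normal v p : dot (horizontal v) (graph_normal p) = dot v p.
Proof.
rewrite /dot big_ord_recl horizontal0 mul0r add0r.
by apply: eq_bigr => i _; rewrite horizontalS graph_normalS.
Qed.

Lemma graph_normal_neq0 p : graph_normal p != 0.
Proof. by rewrite -nsq_gt0 nsq_graph_normal ltr_pwDl// nsq_ge0. Qed.

End GraphNormal.

(** With X = e^(B/t) the right-hand side is t X^2. Since t X >= B, each of the two smallness
    conditions on t lets half of t X^2 absorb one summand on the left. *)
Lemma gradient_bound_absorbed (R : realType) (C k B t : R) :
  0 < C -> 0 < k -> 0 < B -> 0 < t ->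
  t <= B ^+ 2 / (2 * C) -> t <= B * k / (2 * C) ->
  C * (1 + t / k * expR (B / t)) <= t * expR (2 * B / t).
Proof.
move=> C0 k0 B0 t0; rewrite !ler_pdivlMr ?mulr_gt0// => h1 h2.
have -> : expR (2 * B / t) = expR (B / t) ^+ 2 by rewrite -expRM_natl mulrA.
set X := expR (B / t).
have X0 : 0 < X by exact: expR_gt0.
have XB : B <= t * X.
  rewrite mulrC -ler_pdivrMr//; apply: le_trans (expR_ge1Dx _).
  by rewrite lerDr.
have H1 : 2 * C <= t * X ^+ 2.
  rewrite -(ler_pM2l t0); apply: le_trans h1 _.
  have tX0 : 0 < t * X by exact: mulr_gt0.
  rewrite (_ : t * (t * X ^+ 2) = (t * X) ^+ 2); last by ring.
  by rewrite ler_sqr ?nnegrE ?(ltW B0) ?(ltW tX0).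
have H2 : 2 * (C * (t / k * X)) <= t * X ^+ 2.
  have : 2 * C * t <= X * k * t.
    have : B * k <= t * X * k by rewrite ler_pM2r.
    lra.
  rewrite ler_pM2r// -ler_pdivrMr// => H.
  have := ler_wpM2l (mulr_ge0 (ltW t0) (ltW X0)) H.
  lra.
lra.
Qed.

Unset Implicit Arguments.

Theorem theorem1 (R : realType) (n : nat) (F : 'rV[R]_n.+1 -> R) (C1 : R) :
  (0 < n)%N ->
  standing_assumptions F ->
  0 < C1 -> SC F C1 ->
  C1 ^+ 2 < 4 / Num.sqrt (n%:R) ->
  exists (A P q : R),
    [/\ 0 < A, F (- phi0 R n) < P & 1 < q] /\
    forall M : R, 0 < M ->
    exists T0 : R, 0 < T0 /\
    forall (T : R) (u : 'rV[R]_n -> R -> R) (B : 'M[R]_n),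
      0 < T ->
      (exists U : set ('rV[R]_n * R),
          Ck_on 3 (ust u) U /\ (forall y t, 0 <= t <= T -> U (y, t))) ->
      (forall y t, 0 <= t <= T -> AMCF_at F u y t) ->
      (forall y t, 0 <= t <= T -> `|u y t| <= M) ->
      lattice_periodic B u T ->
      forall (x : 'rV[R]_n) (t : R), 0 < t <= Num.min T0 T ->
        F (nu_of u x t) <=
          Num.max (t `^ (q / 2) * expR (A * q * (`|u x t| - 2 * M) ^+ 2 / (4 * t))) P.
Proof.
move=> _ [Fpos _ FC3 Fhom Fcvx] _ _ _.
have FC2 : Ck_on 2 F (~` [set 0]) by exact: Ck_on_le FC3.
have [c c0 cP] := anisotropy_coercive Fpos Fhom FC2 Fcvx.
have [Cf Cf0 CfP] := anisotropy_le_norm Fpos Fhom FC2.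
pose a p i j := F (graph_normal p) *
  D2 F (graph_normal p) (phi R (lift ord0 i)) (phi R (lift ord0 j)).
have nuA (p : 'rV[R]_n) : (~` [set 0]) (graph_normal p).
  by apply/eqP; exact: graph_normal_neq0.
have asym p i j : a p i j = a p j i.
  exact: (congr1 (fun z => F (graph_normal p) * z) (derive_comm _ _ FC2 (nuA p))).
have acoer p v : c * nsq v <= qform (a p) (fun i => v 0 i) * (1 + nsq p).
  have -> : qform (a p) (fun i => v 0 i) =
      F (graph_normal p) * 'D_(horizontal v) ('D_(horizontal v) F) (graph_normal p).
    rewrite /horizontal (derive2_dir_sum _ _ _ _ FC2)// mulr_sumr.
    apply: eq_bigr => i _; rewrite !mulr_sumr; apply: eq_bigr => j _.
    by rewrite /a /D2 /= [RHS]mulrCA -mulrA.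
  have := cP _ (horizontal v) (graph_normal_neq0 p).
  rewrite nsq_graph_normal nsq_horizontal dot_horizontal_normal; apply: le_trans.
  (* Cauchy-Schwarz: |v|^2 (1 + |p|^2) - (v.p)^2 >= |v|^2. *)
  by rewrite ler_pM2l//; have := dot_sq_le v p; lra.
(* With q = 2 and B = 8M^2/c below, A = 32/c is the value for which A q M^2/(4t) = 2B/t. *)
exists (32 / c), (F (- phi0 R n) + 1), 2; split.
  by split; [rewrite divr_gt0|rewrite ltrDl|rewrite ltr1n].
move=> M M0.
pose k := 4 * M / c; pose B := 2 * (k * M).
have k0 : 0 < k by rewrite divr_gt0// mulr_gt0.
have B0 : 0 < B by rewrite mulr_gt0// mulr_gt0.
exists (Num.min (k * M ^+ 2 / 4) (Num.min (B ^+ 2 / (2 * Cf)) (B * k / (2 * Cf)))).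
split.
  have Cf2 : 0 < 2 * Cf by exact: mulr_gt0.
  have kM2 : 0 < k * M ^+ 2 by rewrite mulr_gt0// exprn_gt0.
  have B2 : 0 < B ^+ 2 by rewrite exprn_gt0.
  have Bk : 0 < B * k by exact: mulr_gt0.
  by rewrite !lt_min; apply/and3P; split; exact: divr_gt0.
move=> T u L T0 [U [uC3 UT]] ueq uM uper x t.
rewrite !le_min => /andP[t0 /andP[/andP[tM /andP[tB tk]] tT]].
have tI : 0 <= t <= T by rewrite tT ltW.
have tI' : 0 < t <= T by rewrite tT t0.
have uC2 : Ck_on 2 (ust u) U by exact: Ck_on_le uC3.
have ueq' y s : 0 <= s <= T ->
    u_t u y s = \sum_i \sum_j a (grad u y s) i j * hess u y s i j.
  by move=> /(ueq y); rewrite /AMCF_at nu_of_grad.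
have G := grad_le uC2 UT asym acoer ueq' uM uper c0 M0 x tI' tM.
rewrite le_max; apply/orP; left.
rewrite nu_of_grad (le_trans (CfP _ (graph_normal_neq0 _)))// nsq_graph_normal.
set p := grad u x t in G *.
have S : Num.sqrt (1 + nsq p) <= 1 + Num.sqrt (nsq p).
  rewrite -[leRHS]ger0_norm ?addr_ge0 ?sqrtr_ge0// -sqrtr_sqr ler_wsqrtr//.
  rewrite sqrrD sqr_sqrtr ?nsq_ge0// expr1n mul1r lerD2r lerDl.
  by rewrite mulrn_wge0// sqrtr_ge0.
apply: le_trans (_ : Cf * (1 + t / k * expR (B / t)) <= _).
  by rewrite ler_pM2l// (le_trans S)// lerD2l.
apply: le_trans (gradient_bound_absorbed Cf0 k0 B0 t0 tB tk) _.
rewrite divff// powRr1 ?(ltW t0)// ler_pM2l// ler_expR.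
(* From |u| <= M one gets 2M - |u| >= M. *)
have M2 : M ^+ 2 <= (`|u x t| - 2 * M) ^+ 2.
  rewrite -[leRHS]sqrrN ler_sqr ?nnegrE; have := uM x t tI; lra.
have -> : 2 * B / t = 32 / c * 2 / (4 * t) * M ^+ 2.
  by rewrite /B /k; field; rewrite !lt0r_neq0.
have -> : 32 / c * 2 * (`|u x t| - 2 * M) ^+ 2 / (4 * t) =
    32 / c * 2 / (4 * t) * (`|u x t| - 2 * M) ^+ 2 by rewrite mulrAC.
by rewrite ler_pM2l// !mulr_gt0 ?invr_gt0// mulr_gt0.
Qed.
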